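(* Let $n\ge2$ and $\boldsymbol{\pi}\in\Delta_n^\circ$. (i) Writing $f(\cdot\mid\boldsymbol{\pi},\mathbf{x},\sigma)$ for the continuous density of $\mu_{\boldsymbol{\pi},\mathbf{x},\sigma}$ with respect to the Aitchison measure $\lambda_n$, we have $$\lim_{\sigma\downarrow0}\ \sup_{\mathbf{x},\mathbf{y}\in\Delta_n^\circ}\Big|-\sigma\log f(\mathbf{y}\mid\boldsymbol{\pi},\mathbf{x},\sigma)-\Gamma_{\boldsymbol{\pi}}(\mathbf{y}\,\|\,\mathbf{x})\Big|=0.$$ (ii) For every $\mathbf{x}\in\Delta_n^\circ$, the family $(\mu_{\boldsymbol{\pi},\mathbf{x},\sigma})_{\sigma>0}$ satisfies the large deviation principle on $\Delta_n^\circ$ with rate $1/\sigma$ and rate function $I(\mathbf{y})=\Gamma_{\boldsymbol{\pi}}(\mathbf{y}\,\|\,\mathbf{x})$; that is, for every closed $F\subseteq\Delta_n^\circ$ and open $G\subseteq\Delta_n^\circ$ (relative topology), $$\limsup_{\sigma\downarrow0}\sigma\log\mu_{\boldsymbol{\pi},\mathbf{x},\sigma}(F)\le-\inf_{\mathbf{y}\in F}\Gamma_{\boldsymbol{\pi}}(\mathbf{y}\,\|\,\mathbf{x}),\qquad \liminf_{\sigma\downarrow0}\sigma\log\mu_{\boldsymbol{\pi},\mathbf{x},\sigma}(G)\ge-\inf_{\mathbf{y}\in G}\Gamma_{\boldsymbol{\pi}}(\mathbf{y}\,\|\,\mathbf{x}).$$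
   Context: $\Delta_n^\circ=\{\mathbf{x}\in(0,1]^n:\sum_ix_i=1\}$. For $\mathbf{x}\in(0,\infty)^n$, $\mathcal{C}[\mathbf{x}]=\mathbf{x}/\sum_jx_j$ and $\mathbf{x}^{-1}=(1/x_i)_i$; $\odot$ is the componentwise product. For $\boldsymbol{\pi}\in\Delta_n^\circ$ and $\mathbf{x},\mathbf{y}\in(0,\infty)^n$, $\Gamma_{\boldsymbol{\pi}}(\mathbf{y}\,\|\,\mathbf{x})=\log\big(\sum_i\pi_i\frac{y_i}{x_i}\big)-\sum_i\pi_i\log\frac{y_i}{x_i}$. The scaled Dirichlet distribution $\mathcal{SD}(\boldsymbol{\alpha},\boldsymbol{\beta})$ ($\boldsymbol{\alpha},\boldsymbol{\beta}\in(0,\infty)^n$) is the law of $\mathcal{C}[\mathbf{X}]$ with $X_1,\dots,X_n$ independent, $X_i\sim\mathrm{Gamma}(\text{shape }\alpha_i,\text{ rate }\beta_i)$. For $\sigma>0$ and $\mathbf{x}\in\Delta_n^\circ$, $\mu_{\boldsymbol{\pi},\mathbf{x},\sigma}=\mathcal{SD}\big(\tfrac1\sigma\boldsymbol{\pi},\ \boldsymbol{\pi}\odot\mathbf{x}^{-1}\big)$. The Aitchison measure on $\Delta_n^\circ$ is $d\lambda_n(\mathbf{y})=\frac{1}{\sqrt n\prod_{i=1}^ny_i}dy_1\cdots dy_{n-1}$, where Lebesgue measure on $\{(y_1,\dots,y_{n-1})\in(0,1)^{n-1}:\sum y_i<1\}$ is transported to $\Delta_n^\circ$ via $(y_1,\dots,y_{n-1})\mapsto(y_1,\dots,y_{n-1},1-\sum_{i<n}y_i)$.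 *)

(* Defs.v *)
From HB Require Import structures.
From mathcomp Require Import all_boot all_order all_algebra.
From mathcomp Require Import all_classical all_reals all_analysis.

Set Implicit Arguments.
Unset Strict Implicit.
Unset Printing Implicit Defensive.

Import Order.TTheory GRing.Theory Num.Theory.
Import numFieldNormedType.Exports.

Local Open Scope classical_set_scope.
Local Open Scope ring_scope.

Section Defs.
Variable R : realType.

Definition osimplex (n : nat) : set (n.-tuple R) :=
  [set y | (forall i : 'I_n, 0 < tnth y i <= 1) /\ \sum_(i < n) tnth y i = 1].
Arguments osimplex n : clear implicits.

Definition closure_op (n : nat) (v : n.-tuple R) : n.-tuple R :=
  [tuple tnth v i / (\sum_(j < n) tnth v j) | i < n].

Definition GammaDiv (n : nat) (pi y x : n.-tuple R) : R :=
  ln (\sum_(i < n) tnth pi i * (tnth y i / tnth x i))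
  - \sum_(i < n) tnth pi i * ln (tnth y i / tnth x i).

Definition GammaFun (a : R) : \bar R :=
  (\int[lebesgue_measure]_(t in [set t : R | (0 < t)%R])
      (powR t (a - 1) * expR (- t))%:E)%E.

Definition gamma_pdf (a b : R) (t : R) : R :=
  if 0 < t then powR b a / fine (GammaFun a) * powR t (a - 1) * expR (- (b * t))
  else 0.

Definition mutually_independent d (T : measurableType d) (P : probability T R)
    (n : nat) (X : 'I_n -> T -> R) : Prop :=
  forall B : 'I_n -> set R, (forall i, measurable (B i)) ->
    P [set w | forall i, B i (X i w)] =
    (\prod_(i < n) fine (P (X i @^-1` B i)))%:E.

Definition has_gamma_law d (T : measurableType d) (P : probability T R)
    (a b : R) (X : T -> R) : Prop :=
  forall B : set R, measurable B ->
    P (X @^-1` B) =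
    (\int[lebesgue_measure]_(t in B) (gamma_pdf a b t)%:E)%E.

(** X_1..X_n independent, X_i ~ Gamma(alpha_i, beta_i):
    then  C[X]  has law SD(alpha, beta). *)
Definition SD_family d (T : measurableType d) (P : probability T R)
    (n : nat) (alpha beta : n.-tuple R) (X : 'I_n -> T -> R) : Prop :=
  mutually_independent P X /\
  forall i, has_gamma_law P (tnth alpha i) (tnth beta i) (X i).

Definition law_closure d (T : measurableType d) (P : probability T R)
    (n : nat) (X : 'I_n -> T -> R) (A : set (n.-tuple R)) : \bar R :=
  P ((fun w => closure_op [tuple X i w | i < n]) @^-1` A).

(** Parameters of mu_{pi,x,sigma} = SD(pi/sigma, pi (.) x^{-1}). *)
Definition sd_shape (n : nat) (pi : n.-tuple R) (s : R) : n.-tuple R :=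
  [tuple tnth pi i / s | i < n].
Definition sd_rate (n : nat) (pi x : n.-tuple R) : n.-tuple R :=
  [tuple tnth pi i / tnth x i | i < n].

(** Iterated Lebesgue integral over R^k (coordinates 0..k-1):
    by Tonelli this is the integral w.r.t. k-dimensional Lebesgue measure
    for non-negative measurable integrands. *)
Fixpoint iter_integral (k : nat) (g : (nat -> R) -> \bar R) : \bar R :=
  match k with
  | 0 => g (fun _ => 0)
  | k'.+1 => (\int[lebesgue_measure]_t
                 iter_integral k' (fun v => g (fun j => if j == k' then t else v j)))%E
  end.

Definition simplex_chart (n : nat) (z : nat -> R) : n.-tuple R :=
  [tuple if (val i < n.-1)%N then z (val i)
         else 1 - \sum_(j < n.-1) z j | i < n].

Definition chart_domain (n : nat) : set (nat -> R) :=
  [set z | (forall j : 'I_n.-1, 0 < z j < 1) /\ \sum_(j < n.-1) z j < 1].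

Definition aitchison_integral (n : nat) (A : set (n.-tuple R))
    (g : n.-tuple R -> R) : \bar R :=
  iter_integral n.-1 (fun z =>
    if `[< chart_domain n z /\ A (simplex_chart n z) >] then
      (g (simplex_chart n z) /
        (Num.sqrt (n%:R) * \prod_(i < n) tnth (simplex_chart n z) i))%:E
    else 0%E).

(** sup-distance on R^n (induces the Euclidean topology). *)
Definition supdist (n : nat) (y z : n.-tuple R) : R :=
  \big[Num.max/0]_(i < n) `|tnth y i - tnth z i|.

Definition rel_open (n : nat) (G : set (n.-tuple R)) : Prop :=
  G `<=` osimplex n /\
  forall y, G y -> exists2 e : R, 0 < e &
    forall z, osimplex n z -> supdist z y < e -> G z.

Definition rel_closed (n : nat) (F : set (n.-tuple R)) : Prop :=
  F `<=` osimplex n /\ rel_open (osimplex n `\` F).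

Definition continuous_on_simplex (n : nat) (g : n.-tuple R -> R) : Prop :=
  forall y, osimplex n y -> forall e : R, 0 < e -> exists2 d : R, 0 < d &
    forall z, osimplex n z -> supdist z y < d -> `|g z - g y| < e.

Definition elog (u : \bar R) : \bar R :=
  match u with
  | r%:E => if 0 < r then (ln r)%:E else -oo%E
  | +oo%E => +oo%E
  | -oo%E => -oo%E
  end.

End Defs.

Arguments osimplex {R} n.

(* Main.v *)
(** Fix the shapes [pi_i / s] and rates [pi_i / x_i].  Writing the independent
    gamma variables as [X_i = r * y_i], with [r] their sum and [y] in the simplex, and
    integrating out [r], shows that [C[X]] has the explicit density
      [K s * exp (- Gamma_pi(y || x) / s) / (y_1 ... y_n)]
    with respect to Lebesgue measure in the chart, where [K s] does not depend on [x].
    No Stirling estimate is needed for [s * ln (K s) --> 0]: the total mass is 1,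
    [Gamma_pi >= 0] gives [K 1 <= K s] for [s <= 1], and [Gamma_pi] being small near
    [y = x] gives [K s <= exp (delta / s) / c].  A continuous Aitchison density must then
    equal [sqrt n * K s * exp (- Gamma_pi / s)], whence (i).  For the upper bound in (ii),
    if [Gamma_pi >= I] on [F], the density is at most [K s / K 1 * exp (- I * (1/s - 1))] times
    the probability density for [s = 1], so no tightness is needed; the lower bound keeps only
    a small box inside [G]. *)

Require Import Defs.
From HB Require Import structures.
From mathcomp Require Import all_boot all_order all_algebra.
From mathcomp Require Import all_classical all_reals all_analysis.
From mathcomp Require Import measurable_realfun ring lra.

Set Implicit Arguments.
Unset Strict Implicit.
Unset Printing Implicit Defensive.

Import Order.TTheory GRing.Theory Num.Theory.
Import numFieldNormedType.Exports.

Local Open Scope classical_set_scope.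
Local Open Scope ring_scope.

(** * Iterated Lebesgue integrals over finitely many coordinates, and Tonelli's theorem for them *)

Section coordinate_integrals.
Context {R : realType}.
Local Notation leb := (@lebesgue_measure R).
Implicit Types (v : nat -> R) (g : (nat -> R) -> \bar R).

Definition upd v (j : nat) (t : R) : nat -> R := fun i => if i == j then t else v i.

Lemma upd_swap v i j s t : i != j -> upd (upd v i s) j t = upd (upd v j t) i s.
Proof.
move=> ij; apply/funext => k; rewrite /upd.
by case: eqP => // ->; rewrite eq_sym (negbTE ij).
Qed.

(** A pi-system containing the whole space: it generates the sigma-algebra of [env n], and two
    measures agreeing on it can be identified, as in [joint_density]. *)
Definition boxes (n : nat) : set (set (nat -> R)) :=
  [set S | exists2 B : nat -> set R, (forall i, measurable (B i)) &
     S = [set v | forall i, (i < n)%N -> B i (v i)]].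

(* As in [iter_integral], points of R^n are functions [nat -> R]; only the first [n]
   coordinates are measurable. *)
Definition env n := g_sigma_algebraType (boxes n).
HB.instance Definition _ n := Measurable.on (env n).

Local Notation measurable_env_fun n g :=
  (measurable_fun [set: env n] (g : env n -> \bar _)).

Lemma boxes_setI n : setI_closed (boxes n).
Proof.
move=> _ _ [B mB ->] [C mC ->]; exists (fun i => B i `&` C i).
  by move=> i; exact: measurableI.
apply/seteqP; split=> v /=.
  by move=> [vB vC] i ni; split; [exact: vB|exact: vC].
by move=> vBC; split => i ni; have [] := vBC i ni.
Qed.

Lemma boxes_setT n : boxes n setT.
Proof. by exists (fun=> setT) => //; apply/seteqP; split. Qed.

Lemma measurable_coord n j : (j < n)%N ->
  measurable_fun [set: env n] (fun v : env n => v j).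
Proof.
move=> jn _ B mB; rewrite setTI; apply: sub_sigma_algebra.
exists (fun i => if i == j then B else setT) => [i|]; first by case: ifP.
apply/seteqP; split=> v /=.
  by move=> Bv i ni; case: eqP => // ->.
by move=> /(_ j jn); rewrite eqxx.
Qed.

Lemma measurable_env n d (T : measurableType d) (f : T -> env n) :
  (forall j, (j < n)%N -> measurable_fun setT (fun t => f t j)) ->
  measurable_fun setT f.
Proof.
move=> mf; apply: (@measurability _ _ _ (env n) _ _ (boxes n)) => // _ [_ [B mB ->] <-].
rewrite setTI (_ : _ @^-1` _ = \big[setI/setT]_(i < n)
    ((fun t => f t i) @^-1` (B i))).
  apply: bigsetI_measurable => i _; rewrite -[X in measurable X]setTI.
  exact: mf.
rewrite -(bigcap_mkord n (fun i => (fun t => f t i) @^-1` B i)); apply/seteqP; split=> t /=.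
  by move=> h i /= ni; exact: h.
by move=> h i ni; exact: h.
Qed.

Lemma measurable_upd n j : (j < n)%N ->
  measurable_fun [set: env n * R] (fun z : env n * R => (upd z.1 j z.2 : env n)).
Proof.
move=> jn; apply: measurable_env => i ni; rewrite /upd.
case: eqP => _; first exact: measurable_snd.
by apply: (@measurableT_comp _ _ _ _ _ _ (fun v : env n => v i)) => //; exact: measurable_coord.
Qed.

Lemma measurable_updr n j v : (j < n)%N ->
  measurable_fun [set: R] (fun t => (upd v j t : env n)).
Proof.
move=> jn; apply: measurable_env => i ni; rewrite /upd.
by case: eqP => _ //; exact: measurable_cst.
Qed.

Local Open Scope ereal_scope.

(** Integrating out coordinate [j] again gives a function of all coordinates, constant in the [j]th,
    so that such integrations can be composed and permuted. *)
Definition intc j g v := \int[leb]_t g (upd v j t).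

Fixpoint intn k g := if k is k'.+1 then intc k' (intn k' g) else g.

Lemma intc_ge0 j g : (forall v, 0 <= g v) -> forall v, 0 <= intc j g v.
Proof. by move=> g0 v; apply: integral_ge0 => t _. Qed.

Lemma intn_ge0 k g : (forall v, 0 <= g v) -> forall v, 0 <= intn k g v.
Proof. by move=> g0; elim: k => //= k; exact: intc_ge0. Qed.

Lemma measurable_intc n j g : (j < n)%N -> (forall v, 0 <= g v) ->
  measurable_env_fun n g ->
  measurable_env_fun n (intc j g).
Proof.
move=> jn g0 mg.
apply: (@measurable_fun_fubini_tonelli_F _ _ (env n) _ R leb
  (fun z : env n * R => g (upd z.1 j z.2))) => //.
exact: (measurableT_comp mg (measurable_upd jn)).
Qed.

Lemma measurable_intn n k g : (k <= n)%N -> (forall v, 0 <= g v) ->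
  measurable_env_fun n g ->
  measurable_env_fun n (intn k g).
Proof.
move=> kn g0 mg; elim: k kn => //= k IH kn.
by apply: measurable_intc => //; [exact: intn_ge0|by apply: IH; exact: ltnW].
Qed.

Lemma intcC n i j g : (i < n)%N -> (j < n)%N -> i != j -> (forall v, 0 <= g v) ->
  measurable_env_fun n g ->
  intc i (intc j g) = intc j (intc i g).
Proof.
move=> ni nj ij g0 mg; apply/funext => v; rewrite /intc.
pose G (z : R * R) := g (upd (upd v i z.1) j z.2).
have mG : measurable_fun setT G.
  apply: (measurableT_comp mg); apply: measurable_env => k nk; rewrite /upd.
  by case: eqP => _; [exact: measurable_snd|case: eqP => _; [exact: measurable_fst|exact: measurable_cst]].
have := @fubini_tonelli _ _ _ _ R leb leb G mG (fun z => g0 _).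
rewrite /G /= => ->.
by under eq_integral do under eq_integral do rewrite upd_swap//.
Qed.

Lemma intc_intnC n k j g : (k <= j)%N -> (j < n)%N -> (forall v, 0 <= g v) ->
  measurable_env_fun n g ->
  intc j (intn k g) = intn k (intc j g).
Proof.
move=> kj jn g0 mg; elim: k kj => //= k IH kj.
rewrite -IH; last exact: ltnW.
have kn : (k < n)%N by exact: ltn_trans jn.
rewrite (@intcC n)//; first by rewrite gtn_eqF.
  exact: intn_ge0.
by apply: measurable_intn => //; exact: ltnW.
Qed.

(* The integral is a difference of suprema over simple functions, hence monotone even on
   non-measurable functions. *)
Lemma le_integral_all (f g : R -> \bar R) : (forall t, f t <= g t) ->
  \int[leb]_t f t <= \int[leb]_t g t.
Proof.
have ge0_case (f' g' : R -> \bar R) : (forall t, 0 <= f' t) ->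
    (forall t, f' t <= g' t) -> \int[leb]_t f' t <= \int[leb]_t g' t.
  move=> f0 fg; rewrite !ge0_integralTE//; last by move=> t; exact: le_trans (fg t).
  apply: ereal_sup_le => _ [h /= hf <-]; exists h => // t.
  exact: le_trans (fg t).
move=> fg; rewrite integralE [leRHS]integralE leeB//; apply: ge0_case => // t.
  by apply: (@funepos_le _ _ setT f g); rewrite ?inE.
by apply: (@funeneg_le _ _ setT f g); rewrite ?inE.
Qed.

Lemma le_intn k f g : (forall v, f v <= g v) -> forall v, intn k f v <= intn k g v.
Proof. by move=> fg; elim: k => //= k IH v; exact: le_integral_all. Qed.

Lemma intnZ n k c g v : (k <= n)%N -> 0 <= c -> (forall v, 0 <= g v) ->
  measurable_env_fun n g ->
  intn k (fun w => c * g w) v = c * intn k g v.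
Proof.
move=> kn c0 g0 mg; elim: k v kn => //= k IH v kn.
rewrite {1}/intc; under eq_integral do rewrite IH ?(ltnW kn)//.
rewrite /intc ge0_integralZl//; last by move=> t _; exact: intn_ge0.
by apply: (measurableT_comp (measurable_intn _ g0 mg) (measurable_updr v kn)); exact: ltnW.
Qed.

(** Monotone convergence, one coordinate at a time; it provides the sigma-additivity of
    [density_measure]. *)
Lemma intn_nneseries n k (g : nat -> (nat -> R) -> \bar R) v : (k <= n)%N ->
  (forall i v, 0 <= g i v) ->
  (forall i, measurable_env_fun n (g i)) ->
  intn k (fun w => \sum_(i <oo) g i w) v = \sum_(i <oo) intn k (g i) v.
Proof.
move=> kn g0 mg; elim: k v kn => //= k IH v kn.
rewrite {1}/intc; under eq_integral do rewrite IH ?(ltnW kn)//.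
rewrite /intc integral_nneseries// => [i|i t _].
  by apply: (measurableT_comp (measurable_intn _ (g0 i) (mg i)) (measurable_updr v kn)); exact: ltnW.
exact: intn_ge0.
Qed.

(** Each integration replaces one factor by its integral. The factors of index [k] to [m - 1] are
    carried along as constants, which makes the induction on [k] work. *)
Lemma intn_prod k m (F : nat -> R -> R) (I : nat -> R) v : (k <= m)%N ->
  (forall i, measurable_fun setT (F i)) -> (forall i t, (0 <= F i t)%R) ->
  (forall i, (i < k)%N -> \int[leb]_t (F i t)%:E = (I i)%:E) ->
  intn k (fun v => (\prod_(0 <= i < m) F i (v i))%:E) v =
  ((\prod_(0 <= i < k) I i) * \prod_(k <= i < m) F i (v i))%:E.
Proof.
move=> + mF F0; elim: k v => [|k IH] v km FI /=; first by rewrite (big_geq (leqnn 0)) mul1r.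
rewrite /intc.
have I0 i : (i < k.+1)%N -> (0 <= I i)%R.
  by move=> ik; rewrite -lee_fin -FI//; apply: integral_ge0 => t _; rewrite lee_fin.
transitivity (\int[leb]_t (((\prod_(0 <= i < k) I i) *
    \prod_(k.+1 <= i < m) F i (v i))%:E * (F k t)%:E)).
  apply: eq_integral => t _; rewrite IH//; last first.
  - by move=> i ik; apply: FI; exact: leqW.
  - exact: ltnW.
  rewrite -EFinM -mulrA; congr (_ * _)%:E.
  rewrite big_ltn// mulrC /upd eqxx; congr (_ * _)%R.
  by apply: eq_big_nat => i /andP[ki _]; rewrite gtn_eqF.
rewrite ge0_integralZl//; last 3 first.
- by apply/measurable_EFinP; exact: mF.
- by move=> t _; rewrite lee_fin.
- rewrite lee_fin mulr_ge0//; last by apply: prodr_ge0.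
  rewrite big_seq_cond; apply: prodr_ge0 => i; rewrite mem_index_iota andbT.
  by move=> /andP[_ ik]; apply: I0; exact: leqW.
by rewrite FI// -EFinM big_nat_recr//=; congr (_%:E); rewrite mulrAC.
Qed.

End coordinate_integrals.

Notation measurable_env_fun n g :=
  (measurable_fun [set: env n] (g : env n -> \bar _)).

(** * Affine changes of variable on the line *)

Section affine_substitution.
Context {R : realType}.
Local Notation leb := (@lebesgue_measure R).

(** The right-hand side is the image of Lebesgue measure under [t -> a * t + b], multiplied by [a].
    It gives half-open intervals their length, and uniqueness of Lebesgue measure concludes. *)
Lemma lebesgue_measure_affine (a b : R) (A : set R) : 0 < a -> measurable A ->
  leb A = (a%:E * leb ((fun t => (a * t + b)%R) @^-1` A))%E.
Proof.
move=> a0 mA.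
have mphi : measurable_fun [set: measurableTypeR R]
    (fun t : measurableTypeR R => (a * t + b : measurableTypeR R)).
  by apply: measurable_funD => //; apply: measurable_funM.
pose m : {measure set (measurableTypeR R) -> \bar R} :=
  mscale (NngNum (ltW a0))
    (measure_function_pushforward__canonical__measure_function_Measure leb mphi).
suff -> : leb A = m A by [].
apply: lebesgue_measure_unique => //= _ [[c d]] _ <-.
rewrite /m /= /mscale /= /pushforward.
rewrite (_ : _ @^-1` _ = `](c - b) / a, (d - b) / a]%classic); last first.
  apply/seteqP; split => t /=; rewrite !in_itv/= ltr_pdivrMr// ler_pdivlMr//;
  by rewrite ltrBlDr lerBrDr (mulrC t).
rewrite !lebesgue_measure_itv/= !lte_fin ltr_pM2r ?invr_gt0// ltrD2r.
case: ifPn => _; last by rewrite mule0.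
by rewrite -!EFinD -EFinM; congr (_%:E); rewrite -mulrBl mulrC divfK ?gt_eqF//; ring.
Qed.

Lemma ge0_integral_affine (a b : R) (f : R -> \bar R) : 0 < a ->
  measurable_fun setT f -> (forall t, 0 <= f t)%E ->
  (\int[leb]_t f t = a%:E * \int[leb]_t f (a * t + b)%R)%E.
Proof.
move=> a0 mf f0.
have mphi : measurable_fun [set: measurableTypeR R]
    (fun t : measurableTypeR R => (a * t + b : measurableTypeR R)).
  by apply: measurable_funD => //; apply: measurable_funM.
transitivity (\int[mscale (NngNum (ltW a0))
    (measure_function_pushforward__canonical__measure_function_Measure leb mphi)]_t f t)%E.
  by apply: eq_measure_integral => A mA _; exact: lebesgue_measure_affine.
rewrite ge0_integral_mscale//=; congr (_ * _)%E.
by rewrite (ge0_integral_pushforward mphi)//= preimage_setT.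
Qed.

End affine_substitution.

(** * Radius and direction coordinates on the positive orthant *)

Section cone_coordinates.
Context {R : realType}.
Local Notation leb := (@lebesgue_measure R).
Implicit Types (v : nat -> R) (g : (nat -> R) -> \bar R).

Definition scale (k : nat) (s : R) v : nat -> R :=
  fun i => if (i < k)%N then s * v i else v i.

(** The point with radius [s], the sum of the coordinates [0] to [m], and with direction the simplex
    point whose chart coordinates are [v]. *)
Definition cone (m : nat) (s : R) v : nat -> R := fun i =>
  if (i < m)%N then s * v i else
  if i == m then s * (1 - \sum_(j < m) v j) else v i.

Lemma intn_upd k j t g v : (k <= j)%N ->
  intn k g (upd v j t) = intn k (fun w => g (upd w j t)) v.
Proof.
elim: k v => //= k IH v kj; apply: eq_integral => s _.
by rewrite upd_swap ?gtn_eqF// IH//; exact: ltnW.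
Qed.

Lemma measurable_scale n k s : measurable_fun [set: env n] (scale k s : env n -> env n).
Proof.
apply: measurable_env => i ni; rewrite /scale; case: (i < k)%N; last exact: measurable_coord.
by apply: measurable_funM => //; exact: measurable_coord.
Qed.

Lemma intn_scale n k s g v : (k <= n)%N -> 0 < s -> (forall v, 0 <= g v)%E ->
  measurable_env_fun n g ->
  intn k g v = ((s ^+ k)%:E * intn k (g \o scale k s) v)%E.
Proof.
move=> + s0 g0 mg.
have mgs j : measurable_env_fun n (g \o scale j s).
  exact: (measurableT_comp mg (@measurable_scale n j s)).
elim: k v => [|k IH] v kn /=; first by rewrite expr0 mul1e.
rewrite /intc.
have mint (h : (nat -> R) -> \bar R) : (forall w, 0 <= h w)%E -> measurable_env_fun n h ->
    measurable_fun setT (fun t => intn k h (upd v k t)).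
  move=> h0 mh; apply: (measurableT_comp (measurable_intn _ h0 mh) (measurable_updr v kn)).
  exact: ltnW.
rewrite (ge0_integral_affine 0 s0); last 2 first.
- exact: mint.
- by move=> t; exact: intn_ge0.
rewrite -ge0_integralZl//; last 3 first.
- have : measurable_fun [set: R] (fun t : R => s * t + 0).
    by apply: measurable_funD => //; apply: measurable_funM.
  exact: (measurableT_comp (mint _ g0 mg)).
- by move=> t _; exact: intn_ge0.
- by rewrite lee_fin ltW.
rewrite -ge0_integralZl//; last 3 first.
- exact: (mint _ (fun w => g0 _) (mgs k.+1)).
- by move=> t _; apply: intn_ge0 => w; exact: g0.
- by rewrite lee_fin exprn_ge0// ltW.
apply: eq_integral => t _; rewrite addr0 IH; last exact: ltnW.
rewrite muleA -EFinM -exprS; congr (_ * _)%E.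
rewrite !intn_upd//; congr (intn k _ v); apply/funext => w /=; congr (g _).
apply/funext => i; rewrite /scale /upd (ltnS i k) (leq_eqVlt i k).
by case: (ltngtP i k).
Qed.

(* Substitute [x_m = r - \sum_(i < m) x_i], a translation of the last coordinate, then
   [x_i = r * z_i], dilations of the others; Tonelli moves the integral over [r] in and out. *)
Lemma cone_change_of_variables m G v0 : (forall v, 0 <= G v)%E ->
  measurable_env_fun m.+1 G ->
  (forall v i, (i <= m)%N -> v i <= 0 -> G v = 0%E) ->
  intn m.+1 G v0 = intn m (fun v => \int[leb]_t
    (if (0 < t)%R then (t ^+ m)%R%:E * G (cone m t v) else 0))%E v0.
Proof.
move=> G0 mG Gpos; have mm1 : (m <= m.+1)%N by [].
pose S v := \sum_(j < m) v j.
have mS : measurable_fun [set: env m.+1] (S : env m.+1 -> R).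
  by apply: measurable_sum => i; apply: measurable_coord; rewrite ltnW// ltnS.
have Supd v t : S (upd v m t) = S v.
  by apply: eq_bigr => i _; rewrite /upd ltn_eqF.
(* In [G1] the coordinate of index [m] has become the radius, that is, the sum of all
   coordinates. *)
pose G1 v := G (upd v m (v m - S v)).
have G10 v : (0 <= G1 v)%E by exact: G0.
have mG1 : measurable_env_fun m.+1 G1.
  apply: (measurableT_comp mG); apply: measurable_env => i im; rewrite /upd.
  case: eqP => _; last exact: measurable_coord.
  by apply: measurable_funB => //; exact: measurable_coord.
(* A nonpositive radius forces some coordinate of the original point to be nonpositive, where [G]
   vanishes. Only positive radii remain, as dilating requires. *)
have G1_neg v : v m <= 0 -> G1 v = 0%E.
  move=> vm; have [/existsP[/= i vi]|/existsPn vpos] := boolP [exists i : 'I_m, v i <= 0].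
    by apply: (Gpos _ i); [exact: ltnW|rewrite /upd ltn_eqF].
  apply: (Gpos _ m) => //; rewrite /upd eqxx subr_le0 (le_trans vm)//.
  by apply: sumr_ge0 => i _; rewrite ltW// ltNge.
(* The factor [v m ^+ m] is the Jacobian of the [m] dilations. *)
pose G2 v := (if (0 < v m)%R then (v m ^+ m)%R%:E * G1 (scale m (v m) v) else 0)%E.
have G20 v : (0 <= G2 v)%E.
  by rewrite /G2; case: ifPn => // vm; rewrite mule_ge0// lee_fin exprn_ge0// ltW.
have mG2 : measurable_env_fun m.+1 G2.
  rewrite /G2; apply: measurable_fun_ifT.
  - by apply: measurable_fun_ltr => //; exact: measurable_coord.
  - apply: emeasurable_funM.
      by apply/measurable_EFinP; apply: measurable_funX; exact: measurable_coord.
    apply: (measurableT_comp mG1); apply: measurable_env => i im; rewrite /scale.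
    case: (i < m)%N; last exact: measurable_coord.
    by apply: measurable_funM => //; exact: measurable_coord.
  - exact: measurable_cst.
have shift : intc m G = intc m G1.
  apply/funext => v; rewrite /intc (@ge0_integral_affine _ 1 (- S v))//; last first.
    exact: (measurableT_comp mG (measurable_updr v _)).
  rewrite mul1e; apply: eq_integral => t _.
  rewrite /G1 Supd mul1r; congr (G _); apply/funext => i; rewrite /upd eqxx.
  by case: ifP.
have rescale : intc m (intn m G1) = intc m (intn m G2).
  apply/funext => v; apply: eq_integral => t _; rewrite !intn_upd//.
  have [t0|t0] := leP t 0.
    congr (intn m _ v); apply/funext => w.
    by rewrite G1_neg /G2 /upd eqxx//= ltNge t0.
  rewrite (@intn_scale m.+1 _ t)//; last first.
    by apply: (measurableT_comp mG1); apply: measurable_env => i im; rewrite /upd;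
      case: eqP => _; [exact: measurable_cst|exact: measurable_coord].
  rewrite -(@intnZ _ m.+1)//; last 3 first.
  - by rewrite lee_fin exprn_ge0// ltW.
  - by move=> w; exact: G0.
  - apply: (measurableT_comp mG1); apply: measurable_env => i im; rewrite /upd.
    case: eqP => _; first exact: measurable_cst.
    rewrite /scale; case: (i < m)%N; last exact: measurable_coord.
    by apply: measurable_funM => //; exact: measurable_coord.
  congr (intn m _ v); apply/funext => w; rewrite /G2 /upd eqxx t0; congr (_ * G1 _)%E.
  apply/funext => i; rewrite /scale; case: (ltngtP i m) => // im.
(* Innermost, coordinate [m] is translated while the others are fixed; outermost, it is the fixed
   factor of the dilations; the target needs it innermost again. *)
have -> : intn m.+1 G = intn m (intc m G2).
  rewrite /= (@intc_intnC _ m.+1)// shift -(@intc_intnC _ m.+1)// rescale.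
  by rewrite (@intc_intnC _ m.+1).
congr (intn m _ v0); apply/funext => v; apply: eq_integral => t _.
rewrite /G2 (_ : upd v m t m = t); last by rewrite /upd eqxx.
case: ifPn => // t0; congr (_ * _)%E.
rewrite /G1 /S; congr (G _); apply/funext => i; rewrite /cone /upd /scale ltnn !eqxx.
case: (ltngtP i m) => // im.
by rewrite mulrBr mulr1 mulr_sumr; congr (_ - _); apply: eq_bigr => j _; rewrite ltn_ord ltn_eqF.
Qed.

End cone_coordinates.

(** * The measure with a given density, built from iterated integrals *)

Section density_measure.
Context {R : realType} (n : nat) (p : (nat -> R) -> R).
Hypothesis p0 : forall v, 0 <= p v.
Hypothesis mp : measurable_fun [set: env n] (p : env n -> R).

Definition density_measure (A : set (env n)) : \bar R :=
  intn n (fun v => (\1_A v * p v)%:E) (fun=> 0).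

Let integrand_ge0 (A : set (nat -> R)) v : (0 <= (\1_A v * p v)%:E)%E.
Proof. by rewrite lee_fin mulr_ge0// indicE. Qed.

Let integrand_measurable (A : set (env n)) : measurable A ->
  measurable_env_fun n (fun v => (\1_A v * p v)%:E).
Proof.
by move=> mA; apply/measurable_EFinP; apply: measurable_funM.
Qed.

Let density_measure0 : density_measure set0 = 0%E.
Proof.
rewrite /density_measure (_ : (fun v => _) = fun v => (0 * (\1_set0 v * p v)%:E)%E).
  by rewrite (@intnZ _ n)// ?mul0e//; exact: integrand_measurable.
by apply/funext => v; rewrite indicE in_set0 !mul0r mul0e.
Qed.

Let density_measure_ge0 A : (0 <= density_measure A)%E.
Proof. exact: intn_ge0. Qed.

Let density_measure_sigma_additive : semi_sigma_additive density_measure.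
Proof.
move=> F mF tF mUF.
rewrite [X in _ --> X](_ : _ = \sum_(i <oo) density_measure (F i))%E.
  by apply: is_cvg_nneseries => i _ _; exact: density_measure_ge0.
rewrite /density_measure -(@intn_nneseries _ n)//; last first.
  by move=> i; exact: integrand_measurable.
congr (intn n _ _); apply/funext => v.
(* Sigma-additivity of the indicator at [v] is that of the Dirac measure at [v]. *)
transitivity ((p v)%:E * \d_(v : env n) (\bigcup_i F i))%E.
  by rewrite diracE EFinM muleC indicE.
rewrite measure_bigcup//.
under eq_eseriesl do rewrite in_setT.
rewrite -nneseriesZl//.
by apply: eq_eseriesr => i _; rewrite /= /dirac EFinM muleC.
Qed.

HB.instance Definition _ := isMeasure.Build _ _ _ density_measure
  density_measure0 density_measure_ge0 density_measure_sigma_additive.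

Definition density_measure_measure : {measure set (env n) -> \bar R} :=
  density_measure.

End density_measure.

(** * The joint density of independent variables *)

Section joint_law.
Context {R : realType} d (T : measurableType d) (P : probability T R) (n : nat).
Variables (X : 'I_n -> {RV P >-> R}) (F : nat -> R -> R).
Hypothesis indepX : mutually_independent P (fun i => X i).
Hypothesis mF : forall i, measurable_fun setT (F i).
Hypothesis F0 : forall i t, 0 <= F i t.
Hypothesis lawX : forall (i : 'I_n) (B : set R), measurable B ->
  P (X i @^-1` B) = (\int[lebesgue_measure]_(t in B) (F i t)%:E)%E.

(** Indices from [n] on receive the default value [0], which turns a vector of [n] variables into a
    point of [env n]. *)
Definition env_of (w : T) : nat -> R := fun i => oapp (X ^~ w) 0 (insub i).

Lemma env_ofE w (i : 'I_n) : env_of w i = X i w.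
Proof. by rewrite /env_of valK. Qed.

Lemma measurable_env_of : measurable_fun setT (env_of : T -> env n).
Proof.
apply: measurable_env => j jn.
rewrite (_ : (fun t => _) = X (Ordinal jn)).
  exact: measurable_funP.
by apply/funext => t; rewrite -env_ofE.
Qed.

Lemma measurable_prod_coord :
  measurable_fun [set: env n] (fun v : env n => \prod_(0 <= i < n) F i (v i)).
Proof.
rewrite (_ : (fun v => _) = fun v : env n => \prod_(i < n) F i (v i)); last first.
  by apply/funext => v; rewrite big_mkord.
apply: measurable_prod => i _; apply: (measurableT_comp (mF i)).
exact: measurable_coord.
Qed.

(** Both sides are measures in [A]. On a box, independence turns the left one into a product of
    marginals and [intn_prod] does the same for the right one. *)
Lemma joint_density (A : set (env n)) : measurable A ->
  P (env_of @^-1` A) =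
  intn n (fun v => (\1_A v * \prod_(0 <= i < n) F i (v i))%:E) (fun=> 0).
Proof.
move=> mA; pose p v := \prod_(0 <= i < n) F i (v i).
have p0 v : 0 <= p v by apply: prodr_ge0.
pose m1 := measure_function_pushforward__canonical__measure_function_Measure
   P measurable_env_of.
pose m2 := density_measure_measure p0 measurable_prod_coord.
suff : m1 A = m2 A by [].
apply: (@measure_unique _ R (env n) (boxes n) (fun=> setT)) => //.
- exact: boxes_setI.
- by move=> _; exact: boxes_setT.
- by apply/seteqP; split => // v _; exists 0%N.
- move=> _ [B mB ->].
  transitivity (P [set w | forall i : 'I_n, B i (X i w)]).
    congr (P _); apply/seteqP; split => w /=.
      by move=> h i; have := h i (ltn_ord i); rewrite env_ofE.
    by move=> h i ni; have := h (Ordinal ni); rewrite -env_ofE.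
  rewrite (indepX (fun i : 'I_n => mB i)) /m2 /= /density_measure.
  pose H i t := \1_(B i) t * F i t : R.
  have HE (i : 'I_n) : (\int[lebesgue_measure]_t (H i t)%:E)%E = P (X i @^-1` B i).
    rewrite lawX// [RHS]integral_mkcond; apply: eq_integral => t _.
    by rewrite epatch_indic /H EFinM muleC.
  (* The indicator of a box is a product of one-variable indicators, so the integrand factors. *)
  rewrite (_ : (fun v => _) = fun v => (\prod_(0 <= i < n) H i (v i))%:E); last first.
    apply/funext => v; congr (_%:E); rewrite /H big_split/= -/(p v); congr (_ * _).
    rewrite big_mkord indicE; case: (boolP (v \in _)) => [|/negP].
      by rewrite inE /= => Bv; rewrite big1// => i _; rewrite indicE mem_set//; exact: Bv.
    rewrite inE /= => /existsNP[i /not_implyP[ni Bi]].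
    by rewrite (bigD1 (Ordinal ni))//= indicE memNset// mul0r.
  rewrite (@intn_prod _ _ _ _ (fun i => fine (\int[lebesgue_measure]_t (H i t)%:E)%E))//.
  + rewrite (big_geq (leqnn n)) mulr1 big_mkord; congr (_%:E).
    by apply: eq_bigr => i _; rewrite HE.
  + by move=> i; apply: measurable_funM.
  + by move=> i t; rewrite mulr_ge0// indicE.
  + move=> i ni; rewrite fineK// (HE (Ordinal ni)).
    by apply: fin_num_measure; rewrite -[X in measurable X]setTI; exact: measurable_funP.
- move=> _; apply: (@le_lt_trans _ _ 1%E); last exact: ltry.
  by apply: probability_le1; rewrite preimage_setT.
Qed.

End joint_law.

(** * The gamma densities in cone coordinates and the integral over the radius *)

Section scaled_dirichlet_density.
Context {R : realType}.
Local Notation leb := (@lebesgue_measure R).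

Definition env_tuple n (v : nat -> R) : n.-tuple R := [tuple v i | i < n].

Lemma coneE m t (v : nat -> R) (i : 'I_m.+1) :
  cone m t v i = t * tnth (simplex_chart m.+1 v) i.
Proof.
rewrite /cone tnth_mktuple /=; have := ltn_ord i; rewrite ltnS leq_eqVlt.
by case: ltngtP.
Qed.

Lemma simplex_chart_sum m (v : nat -> R) :
  \sum_(i < m.+1) tnth (simplex_chart m.+1 v) i = 1.
Proof.
rewrite big_ord_recr/= tnth_mktuple/= ltnn.
under eq_bigr do rewrite tnth_mktuple/= ltn_ord.
by rewrite addrC subrK.
Qed.

Lemma closure_op_cone m t (v : nat -> R) : 0 < t ->
  closure_op (env_tuple m.+1 (cone m t v)) = simplex_chart m.+1 v.
Proof.
move=> t0; apply: eq_from_tnth => i; rewrite tnth_mktuple.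
under eq_bigr do rewrite tnth_mktuple coneE.
by rewrite -mulr_sumr simplex_chart_sum mulr1 tnth_mktuple coneE mulrC mulKf// gt_eqF.
Qed.

Lemma osimplex_gt0 n (y : n.-tuple R) i : osimplex n y -> 0 < tnth y i.
Proof. by move=> [/(_ i)/andP[]]. Qed.

Lemma osimplex_ge m (y : m.+1.-tuple R) : (forall i, 0 < tnth y i) ->
  \sum_(i < m.+1) tnth y i = 1 -> osimplex m.+1 y.
Proof.
move=> y0 y1; split=> // i; rewrite y0/= -y1 (bigD1 i)//= lerDl.
by apply: sumr_ge0 => j _; exact: ltW.
Qed.

Lemma prod_expR (I : Type) (r : seq I) (Q : pred I) (f : I -> R) :
  \prod_(i <- r | Q i) expR (f i) = expR (\sum_(i <- r | Q i) f i).
Proof. by rewrite (big_morph expR (@expRD R) (@expR0 R)). Qed.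

Lemma GammaFun_ge0 (a : R) : (0 <= GammaFun a)%E.
Proof. by apply: integral_ge0 => t _; rewrite lee_fin mulr_ge0// ?powR_ge0 ?expR_ge0. Qed.

Lemma measurable_gamma_integrand (a b : R) :
  measurable_fun setT (fun t : R => if 0 < t then powR t (a - 1) * expR (- (b * t)) else 0).
Proof.
apply: measurable_fun_ifT => //; first exact: measurable_fun_ltr.
apply: measurable_funM; first exact: measurable_powR.
by apply: measurableT_comp => //; apply: measurableT_comp => //; exact: measurable_funM.
Qed.

Lemma measurable_gamma_pdf (a b : R) : measurable_fun setT (gamma_pdf a b).
Proof.
rewrite (_ : gamma_pdf a b = fun t => powR b a / fine (GammaFun a) *
    (if 0 < t then powR t (a - 1) * expR (- (b * t)) else 0)).
  by apply: measurable_funM => //; exact: measurable_gamma_integrand.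
by apply/funext => t; rewrite /gamma_pdf; case: ifP => _; rewrite ?mulr0// mulrA.
Qed.

Lemma gamma_pdf_ge0 (a b t : R) : 0 <= gamma_pdf a b t.
Proof.
rewrite /gamma_pdf; case: ifP => // _; rewrite !mulr_ge0 ?powR_ge0 ?expR_ge0//.
by rewrite invr_ge0 fine_ge0// GammaFun_ge0.
Qed.

(** The substitution [t -> b * t] in Euler's integral. The identity is in the extended reals because
    finiteness of the Gamma integral at [1 / s] comes only later, from the total mass. *)
Lemma GammaFun_rate (a b : R) : 0 < b ->
  GammaFun a = ((powR b a)%:E *
   \int[leb]_t (if 0 < t then powR t (a - 1) * expR (- (b * t)) else 0)%:E)%E.
Proof.
move=> b0; rewrite /GammaFun integral_mkcond.
pose f t := ((if 0 < t then powR t (a - 1) * expR (- (1 * t)) else 0) : R)%:E.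
transitivity (\int[leb]_t f t)%E.
  apply: eq_integral => t _; rewrite /f patchE mul1r.
  by case: ifPn => [|/negP]; rewrite inE/= => t0; [rewrite t0|case: ifPn].
have f0 t : (0 <= f t)%E.
  by rewrite lee_fin; case: ifP => // _; rewrite mulr_ge0 ?powR_ge0 ?expR_ge0.
have mf : measurable_fun setT f.
  by apply/measurable_EFinP; exact: measurable_gamma_integrand.
rewrite (ge0_integral_affine 0 b0 mf f0).
have g0 t : (0 <= (if (0 < t)%R then powR t (a - 1) * expR (- (b * t)) else 0)%:E :> \bar R)%E.
  by rewrite lee_fin; case: ifP => // _; rewrite mulr_ge0 ?powR_ge0 ?expR_ge0.
have ba : powR b a = b * powR b (a - 1).
  rewrite -{2}(powRr1 (ltW b0)) -powRD; last by apply/implyP => _; rewrite gt_eqF.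
  by rewrite addrC subrK.
rewrite ba EFinM -muleA; congr (_ * _)%E.
rewrite -ge0_integralZl//; last 2 first.
- by apply/measurable_EFinP; exact: measurable_gamma_integrand.
- by rewrite lee_fin powR_ge0.
apply: eq_integral => t _; rewrite /f addr0 pmulr_rgt0// mul1r -EFinM; congr (_%:E).
by case: ifP => t0; rewrite ?mulr0// powRM ?(ltW t0) ?ltW// mulrA.
Qed.

(** The density of the scaled Dirichlet law against Lebesgue measure in the chart, up to
    normalisation. *)
Definition sd_kernel n (pi : n.-tuple R) (s : R) (x y : n.-tuple R) : R :=
  expR (- (GammaDiv pi y x / s)) / \prod_(i < n) tnth y i.

(** From the rates [pi_i / x_i] only the [pi_i] are kept here; the [x_i] are absorbed by the
    divergence in [sd_kernel], which makes this constant independent of [x]. *)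
Definition sd_const n (pi : n.-tuple R) (s : R) : R :=
  \prod_(i < n) (powR (tnth pi i) (tnth pi i / s) / fine (GammaFun (tnth pi i / s))).

(** The shapes sum to [1 / s], so together with the Jacobian [t ^+ m] the exponent of [t] is
    [m + 1 / s - (m + 1)]. The factor [powR b s^-1] cancels the [ln b] inside [GammaDiv]. *)
Lemma gamma_product m (pi x y : m.+1.-tuple R) (s t : R) :
  osimplex m.+1 pi -> (forall i, 0 < tnth x i) -> (forall i, 0 < tnth y i) ->
  0 < s -> 0 < t ->
  let b := \sum_(i < m.+1) tnth pi i * (tnth y i / tnth x i) in
  t ^+ m * \prod_(i < m.+1)
    gamma_pdf (tnth pi i / s) (tnth pi i / tnth x i) (t * tnth y i) =
  sd_const pi s * sd_kernel pi s x y * powR b s^-1 *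
    (powR t (s^-1 - 1) * expR (- (b * t))).
Proof.
move=> piS x0 y0 s0 t0 b.
have pi0 i : 0 < tnth pi i by exact: osimplex_gt0.
have b0 : 0 < b.
  rewrite /b big_ord_recr/= ltr_wpDl//; last by rewrite mulr_gt0// divr_gt0.
  by apply: sumr_ge0 => i _; rewrite mulr_ge0// ?divr_ge0// ltW.
have powE z w : 0 < z -> powR z w = expR (w * ln z) by rewrite /powR => /gt_eqF ->.
(* [E i] is the logarithm of the [i]th gamma density without its factor [1 / Gamma(pi_i / s)]; the
   claim becomes an identity between sums of logarithms. *)
pose E i := tnth pi i / s * ln (tnth pi i) +
  tnth pi i * (ln (tnth y i) - ln (tnth x i)) / s - ln (tnth y i) +
  (tnth pi i / s - 1) * ln t - tnth pi i * (tnth y i / tnth x i) * t.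
transitivity (\prod_(i < m.+1) (fine (GammaFun (tnth pi i / s)))^-1 *
    expR (m%:R * ln t + \sum_(i < m.+1) E i)).
  have -> : t ^+ m = expR (m%:R * ln t) by rewrite expRM_natl lnK.
  rewrite expRD mulrCA; congr (_ * _); rewrite -prod_expR -big_split/=.
  apply: eq_bigr => i _.
  have bx : 0 < tnth pi i / tnth x i by rewrite divr_gt0.
  have ty : 0 < t * tnth y i by rewrite mulr_gt0.
  rewrite /gamma_pdf ty !powE//.
  rewrite mulrAC -!mulrA mulrCA; congr (_ * _).
  rewrite -!expRD; congr expR; rewrite /E.
  have xV : 0 < (tnth x i)^-1 by rewrite invr_gt0.
  rewrite !(lnM, lnV) ?posrE ?mulr_gt0//; field.
  by rewrite !gt_eqF.
have -> : sd_const pi s = \prod_(i < m.+1) (fine (GammaFun (tnth pi i / s)))^-1 *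
    expR (\sum_(i < m.+1) tnth pi i / s * ln (tnth pi i)).
  rewrite /sd_const big_split/= mulrC -prod_expR; congr (_ * _).
  by apply: eq_bigr => i _; rewrite powE.
have -> : sd_kernel pi s x y = expR (- (GammaDiv pi y x / s) - \sum_(i < m.+1) ln (tnth y i)).
  rewrite /sd_kernel expRD; congr (_ * _); rewrite expRN -prod_expR; congr (_^-1).
  by apply: eq_bigr => i _; rewrite lnK ?posrE.
have -> : GammaDiv pi y x = ln b -
    \sum_(i < m.+1) tnth pi i * (ln (tnth y i) - ln (tnth x i)).
  by rewrite /GammaDiv -/b; congr (_ - _); apply: eq_bigr => i _; rewrite ln_div ?posrE.
rewrite !powE// -!mulrA -!expRD; congr (_ * expR _).
rewrite /E !big_split/= !sumrN -!mulr_suml big_split/= sumrN sumr_const card_ord -mulr_suml.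
rewrite (proj2 piS) -/b -natr1; field.
by rewrite gt_eqF.
Qed.

(** By [gamma_product], what depends on [t] is a gamma integrand of shape [1 / s] and rate [b];
    [GammaFun_rate] evaluates it and absorbs [powR b s^-1]. *)
Lemma cone_integral m (pi x : m.+1.-tuple R) (s : R) (A : set (m.+1.-tuple R)) v :
  osimplex m.+1 pi -> (forall i, 0 < tnth x i) -> 0 < s -> A `<=` osimplex m.+1 ->
  (\int[leb]_t (if (0 < t)%R then (t ^+ m)%R%:E *
    (\1_((fun w => closure_op (env_tuple m.+1 w)) @^-1` A) (cone m t v) *
     \prod_(0 <= i < m.+1) gamma_pdf (pi`_i / s) (pi`_i / x`_i) (cone m t v i))%R%:E
    else 0) =
  (sd_const pi s)%:E * GammaFun s^-1 *
    (\1_A (simplex_chart m.+1 v) * sd_kernel pi s x (simplex_chart m.+1 v))%R%:E)%E.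
Proof.
move=> piS x0 s0 AS; set y := simplex_chart m.+1 v.
have c0 : 0 <= sd_const pi s.
  by apply: prodr_ge0 => i _; rewrite divr_ge0 ?powR_ge0// fine_ge0// GammaFun_ge0.
have indE t : 0 < t ->
    \1_((fun w => closure_op (env_tuple m.+1 w)) @^-1` A) (cone m t v) = \1_A y :> R.
  move=> t0; rewrite !indicE; congr (_%:R); congr (nat_of_bool _).
  by apply/idP/idP; rewrite !inE/= closure_op_cone.
have [yA|yA] := pselect (A y); last first.
  rewrite integral0_eq ?indicE ?memNset// ?mul0r ?mule0// => t _.
  by case: ifPn => // t0; rewrite indE// indicE memNset// mul0r mule0.
have y0 i : 0 < tnth y i by apply: osimplex_gt0; exact: AS.
pose b := \sum_(i < m.+1) tnth pi i * (tnth y i / tnth x i).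
have b0 : 0 < b.
  rewrite /b big_ord_recr/= ltr_wpDl//.
    apply: sumr_ge0 => i _; rewrite mulr_ge0// ?divr_ge0// ltW//; exact: osimplex_gt0.
  by rewrite mulr_gt0// ?divr_gt0//; exact: osimplex_gt0.
have k0 : 0 <= sd_kernel pi s x y.
  by rewrite divr_ge0 ?expR_ge0//; apply: prodr_ge0 => i _; exact: ltW.
rewrite (GammaFun_rate s^-1 b0) indicE mem_set// mul1r.
rewrite muleA (muleAC _ _ (sd_kernel pi s x y)%:E) -!EFinM -ge0_integralZl//; last 3 first.
- by apply/measurable_EFinP; exact: measurable_gamma_integrand.
- by move=> t _; rewrite lee_fin; case: ifP => // _; rewrite mulr_ge0 ?powR_ge0 ?expR_ge0.
- by rewrite lee_fin; exact: (mulr_ge0 (mulr_ge0 c0 (powR_ge0 _ _)) k0).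
apply: eq_integral => t _; case: ifPn => t0; last by rewrite mule0.
rewrite indE// indicE mem_set// mul1r -!EFinM; congr (_%:E).
rewrite big_mkord; have := gamma_product piS x0 y0 s0 t0.
rewrite /= -/b => H.
under eq_bigr do rewrite coneE -!tnth_nth.
rewrite H; ring.
Qed.

End scaled_dirichlet_density.

(** * Measurability of the maps and sets attached to the simplex *)

Section simplex_measurability.
Context {R : realType}.

Lemma measurable_invr : measurable_fun [set: R] (@GRing.inv R).
Proof.
(* Away from [0] the inverse is, up to sign, a power of exponent [-1]; at [0] the convention
   [0^-1 = 0] gives the last case. *)
rewrite (_ : @GRing.inv R = fun x => if 0 < x then powR x (-1) else
    if x < 0 then - powR (- x) (-1) else 0).
  apply: measurable_fun_ifT; first exact: measurable_fun_ltr.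
    exact: measurable_powR.
  apply: measurable_fun_ifT => //; first exact: measurable_fun_ltr.
  apply: measurableT_comp => //.
  by apply: (measurableT_comp (@measurable_powR R (-1))).
apply/funext => x; case: ltgtP => [x0|x0|<-]; last by rewrite invr0.
  by rewrite powR_inv1// ltW.
by rewrite powR_inv1 ?oppr_ge0 ?ltW// invrN opprK.
Qed.

Lemma measurable_fun_div d (T : measurableType d) (f g : T -> R) :
  measurable_fun setT f -> measurable_fun setT g ->
  measurable_fun setT (fun t => f t / g t).
Proof.
by move=> mf mg; apply: measurable_funM => //; exact: measurableT_comp measurable_invr mg.
Qed.

Lemma measurable_closure_op n :
  measurable_fun [set: @env R n] (fun v : env n => closure_op (env_tuple n v)).
Proof.
apply/measurable_fun_tnthP => i.
rewrite (_ : _ \o _ = fun v : env n => v i / \sum_(j < n) v j); last first.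
  apply/funext => v /=; rewrite tnth_mktuple !tnth_mktuple; congr (_ / _).
  by apply: eq_bigr => j _; rewrite tnth_mktuple.
apply: measurable_fun_div; first exact: measurable_coord.
by apply: measurable_sum => j; exact: measurable_coord.
Qed.

Lemma measurable_simplex_chart m :
  measurable_fun [set: @env R m] (fun v : env m => simplex_chart m.+1 v).
Proof.
apply/measurable_fun_tnthP => i; have := ltn_ord i; rewrite ltnS leq_eqVlt => im.
rewrite (_ : _ \o _ = fun v : env m => if (i < m)%N then v i else 1 - \sum_(j < m) v j).
  case: (ltngtP i m) im => // im _; first exact: measurable_coord.
  apply: measurable_funB => //.
  by apply: measurable_sum => j; exact: measurable_coord.
by apply/funext => v; rewrite /= tnth_mktuple.
Qed.

Lemma measurable_osimplex n : measurable (@osimplex R n).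
Proof.
rewrite (_ : @osimplex R n = \big[setI/setT]_(i < n)
    ((@tnth n R ^~ i) @^-1` `](0 : R), 1]%classic) `&`
    ((fun y : n.-tuple R => \sum_(i < n) tnth y i) @^-1` [set 1])); last first.
  apply/seteqP; split=> y /=.
    move=> [y01 y1]; split=> //; elim/big_ind: _ => // i _.
    by rewrite /= in_itv/=; exact: y01.
  move=> [y01 y1]; split=> // i; move: y01; rewrite (bigD1 i)//= => -[].
  by rewrite /= in_itv.
apply: measurableI.
  apply: bigsetI_measurable => i _; rewrite -[X in measurable X]setTI.
  by apply: measurable_tnth.
rewrite -[X in measurable X]setTI.
have ms : measurable_fun [set: n.-tuple R] (fun y : n.-tuple R => \sum_(i < n) tnth y i).
  by apply: measurable_sum => i; exact: measurable_tnth.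
exact: ms.
Qed.

Lemma supdist_ltP n (y z : n.-tuple R) (e : R) : 0 < e ->
  supdist y z < e <-> forall i, `|tnth y i - tnth z i| < e.
Proof.
move=> e0; split => [/bigmax_ltP[_ h] i|h]; first exact: h.
by apply/bigmax_ltP; split.
Qed.

Lemma measurable_supdist_lt n (z : n.-tuple R) (e : R) : 0 < e ->
  measurable [set y | supdist y z < e].
Proof.
move=> e0; rewrite (_ : mkset _ = \big[setI/setT]_(i < n)
    ((@tnth n R ^~ i) @^-1` [set t | `|t - tnth z i| < e])); last first.
  apply/seteqP; split=> y /=.
    by move=> /(supdist_ltP _ _ e0) h; elim/big_ind: _ => // i _; exact: h.
  move=> h; apply/(supdist_ltP _ _ e0) => i.
  by move: h; rewrite (bigD1 i)//= => -[].
apply: bigsetI_measurable => i _; rewrite -[X in measurable X]setTI.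
apply: measurable_tnth => //.
rewrite -[X in measurable X]setTI.
have : measurable_fun [set: R] (fun t : R => `|t - tnth z i| < e).
  apply: measurable_fun_ltr => //; apply: measurableT_comp => //.
  exact: measurable_funB.
by move=> /(_ measurableT [set true]); exact.
Qed.

(* Countably many balls with rational centres and radii 1/(k+1) exhaust a relatively open set. *)
Lemma measurable_rel_open n (G : set (n.-tuple R)) : rel_open G -> measurable G.
Proof.
move=> [GS Gopen].
pose ball_ (p : n.-tuple rat * nat) : set (n.-tuple R) :=
  osimplex n `&` [set z | supdist z [tuple ratr (tnth p.1 i) | i < n] < p.2.+1%:R^-1].
have mball p : measurable (ball_ p).
  by apply: measurableI; [exact: measurable_osimplex|apply: measurable_supdist_lt].
(* The pairs of centre and radius are enumerated by their codes; a code without meaning, or a ball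
   not inside [G], contributes the empty set. *)
pose B k : set (n.-tuple R) := if (unpickle k : option (n.-tuple rat * nat)) is Some p
  then (if `[< ball_ p `<=` G >] then ball_ p else set0) else set0.
suff -> : G = \bigcup_k B k.
  apply: bigcupT_measurable => k; rewrite /B; case: unpickle => // p.
  by case: ifP.
apply/seteqP; split=> [y Gy|y [k _]]; last first.
  by rewrite /B; case: unpickle => // p; case: ifPn => // /asboolP h /h.
have [e e0 He] := Gopen y Gy.
(* With a radius below [e / 2], a ball that contains [y] stays within distance [e] of [y]. *)
have [k ke] : exists k : nat, k.+1%:R^-1 < e / 2.
  have e20 : 0 < e / 2 by rewrite divr_gt0.
  have [k _ hk] := near_infty_natSinv_lt (PosNum e20).
  by exists k; apply: hk => /=.
have k0 : 0 < (k.+1%:R^-1 : R) by rewrite invr_gt0.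
have [q Hq] : exists q : n.-tuple rat, forall i, `|tnth y i - ratr (tnth q i)| < k.+1%:R^-1.
  have H i : exists r : rat, `|tnth y i - ratr r| < k.+1%:R^-1.
    have [|r] := @rat_in_itvoo R (tnth y i - k.+1%:R^-1) (tnth y i + k.+1%:R^-1).
      by rewrite ltrD2l gtrN.
    by rewrite in_itv/= => rin; exists r; rewrite distrC ltr_distl.
  have [q Hq] := choice H.
  by exists [tuple q i | i < n] => i; rewrite tnth_mktuple.
exists (pickle (q, k)) => //; rewrite /B pickleK.
have yball : ball_ (q, k) y.
  split; first exact: GS.
  by apply/supdist_ltP => // i; rewrite tnth_mktuple.
rewrite asboolT// => z [zS /=/(supdist_ltP _ _ k0) zq].
apply: He => //; apply/supdist_ltP => // i.
have := zq i; rewrite tnth_mktuple => {}zq.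
rewrite (le_lt_trans (ler_distD (ratr (tnth q i)) _ _))//.
rewrite [ltRHS]splitr ltrD//; first exact: lt_trans ke.
by rewrite distrC; apply: lt_trans ke.
Qed.

Lemma measurable_rel_closed n (F : set (n.-tuple R)) : rel_closed F -> measurable F.
Proof.
move=> [FS oF]; rewrite (_ : F = @osimplex R n `\` (@osimplex R n `\` F)).
  by apply: measurableD; [exact: measurable_osimplex|exact: measurable_rel_open].
by rewrite setDD setIidr.
Qed.

Lemma measurable_sd_kernel n (pi x : n.-tuple R) (s : R) :
  measurable_fun setT (sd_kernel pi s x).
Proof.
have mt i : measurable_fun [set: n.-tuple R] (fun y : n.-tuple R => tnth y i / tnth x i).
  by apply: measurable_funM => //; exact: measurable_tnth.
apply: measurable_fun_div; last by apply: measurable_prod => i _; exact: measurable_tnth.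
apply: measurableT_comp => //; apply: measurableT_comp => //.
apply: measurable_funM => //; apply: measurable_funB.
  apply: measurableT_comp => //; apply: measurable_sum => i.
  exact: measurable_funM.
by apply: measurable_sum => i; apply: measurable_funM => //; exact: measurableT_comp.
Qed.

End simplex_measurability.

(** * The law of the normalised vector and its normalising constant *)

Section scaled_dirichlet_law.
Context {R : realType} {d : measure_display} {T : measurableType d} {P : probability T R}.
Context {m : nat} (pi : m.+1.-tuple R).
Hypothesis piS : osimplex m.+1 pi.

(** Lebesgue measure in the chart, without the Aitchison weight. For [A] inside the simplex the
    indicator already confines [v] to the chart domain. *)
Definition chart_integral (A : set (m.+1.-tuple R)) (g : m.+1.-tuple R -> R) : \bar R :=
  intn m (fun v => (\1_A (simplex_chart m.+1 v) * g (simplex_chart m.+1 v))%:E) (fun=> 0).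

Lemma measurable_chart_integrand (A : set (m.+1.-tuple R)) (g : m.+1.-tuple R -> R) :
  measurable A -> measurable_fun setT g ->
  measurable_env_fun m
    (fun v => (\1_A (simplex_chart m.+1 v) * g (simplex_chart m.+1 v))%:E).
Proof.
move=> mA mg; apply/measurable_EFinP.
apply: (@measurableT_comp _ _ _ _ _ _ (fun y : m.+1.-tuple R => \1_A y * g y)).
  by apply: measurable_funM.
exact: measurable_simplex_chart.
Qed.

Lemma sd_kernel_ge0 (s : R) (x y : m.+1.-tuple R) : osimplex m.+1 y -> 0 <= sd_kernel pi s x y.
Proof.
by move=> yS; rewrite divr_ge0 ?expR_ge0//; apply: prodr_ge0 => i _; rewrite ltW// osimplex_gt0.
Qed.

Lemma indic_sd_kernel_ge0 (A : set (m.+1.-tuple R)) (s : R) (x y : m.+1.-tuple R) :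
  A `<=` osimplex m.+1 -> 0 <= \1_A y * sd_kernel pi s x y.
Proof.
move=> AS; have [/AS yS|yA] := pselect (A y); last by rewrite indicE memNset// mul0r.
by rewrite mulr_ge0 ?sd_kernel_ge0// indicE.
Qed.

Section fixed_parameters.
Variables (s : R) (x : m.+1.-tuple R) (X : 'I_m.+1 -> {RV P >-> R}).
Hypotheses (s0 : 0 < s) (xS : osimplex m.+1 x).
Hypothesis SDX : SD_family P (sd_shape pi s) (sd_rate pi x) (fun i => X i).

Let F i : R -> R := gamma_pdf (pi`_i / s) (pi`_i / x`_i).

Let lawF (i : 'I_m.+1) (B : set R) : measurable B ->
  P (X i @^-1` B) = (\int[lebesgue_measure]_(t in B) (F i t)%:E)%E.
Proof.
move=> mB; have [_ lawX] := SDX.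
by rewrite (lawX i B mB) !tnth_mktuple !(tnth_nth 0).
Qed.

Let mF i : measurable_fun setT (F i).
Proof. exact: measurable_gamma_pdf. Qed.

Let F0 i t : 0 <= F i t.
Proof. exact: gamma_pdf_ge0. Qed.

Lemma law_closure_density (A : set (m.+1.-tuple R)) : measurable A ->
  law_closure P (fun i => X i) A =
  intn m.+1 (fun v => (\1_((fun w => closure_op (env_tuple m.+1 w)) @^-1` A) v *
    \prod_(0 <= i < m.+1) F i (v i))%:E) (fun=> 0).
Proof.
move=> mA; have [indepX _] := SDX.
rewrite -(joint_density indepX mF F0 lawF).
  rewrite /law_closure; congr (P _).
  apply/funext => w /=; congr (A (closure_op _)); apply: eq_from_tnth => i.
  by rewrite !tnth_mktuple env_ofE.
rewrite -[X in measurable X]setTI.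
exact: (@measurable_closure_op R m.+1).
Qed.

(** The gamma densities vanish off the positive orthant, and vectors with positive coordinates
    normalise into the simplex. *)
Lemma law_osimplex : law_closure P (fun i => X i) (osimplex m.+1) = 1%E.
Proof.
have [indepX _] := SDX.
rewrite law_closure_density; last exact: measurable_osimplex.
rewrite -(@probability_setT _ _ _ P) -[in RHS](@preimage_setT _ _ (env_of X)).
rewrite (joint_density indepX mF F0 lawF)//.
congr (intn _ _ _); apply/funext => v; congr (_%:E).
rewrite [in RHS]indicE in_setT mul1r.
have [/forallP v0|/forallPn[i vi]] := boolP [forall i : 'I_m.+1, 0 < v i].
  rewrite indicE mem_set ?mul1r//=.
  have S0 : 0 < \sum_(j < m.+1) tnth (env_tuple m.+1 v) j.
    rewrite big_ord_recr/= ltr_wpDl// ?tnth_mktuple//.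
    by apply: sumr_ge0 => i _; rewrite tnth_mktuple ltW.
  apply: osimplex_ge => [i|]; first by rewrite !tnth_mktuple divr_gt0.
  under eq_bigr do rewrite tnth_mktuple.
  by rewrite -mulr_suml divff// gt_eqF.
rewrite big_mkord (bigD1 i)//= {1 3}/F /gamma_pdf (negbTE vi) !mul0r.
by rewrite mulr0.
Qed.

(** The joint density is rewritten in cone coordinates; normalisation forgets the radius, which
    [cone_integral] then integrates out. *)
Lemma law_chart (A : set (m.+1.-tuple R)) : measurable A -> A `<=` osimplex m.+1 ->
  law_closure P (fun i => X i) A =
  ((sd_const pi s)%:E * GammaFun s^-1 * chart_integral A (sd_kernel pi s x))%E.
Proof.
move=> mA AS; have x0 i : 0 < tnth x i by exact: osimplex_gt0.
rewrite law_closure_density// cone_change_of_variables; last 3 first.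
- by move=> v; rewrite lee_fin mulr_ge0// ?indicE//; apply: prodr_ge0.
- apply/measurable_EFinP; apply: measurable_funM.
    apply: measurable_indic; rewrite -[X in measurable X]setTI.
    exact: (@measurable_closure_op R m.+1).
  exact: measurable_prod_coord.
- move=> v i im vi; congr (_%:E); rewrite big_mkord.
  rewrite (bigD1 (Ordinal (im : (i < m.+1)%N)))//= {1}/F /gamma_pdf.
  by rewrite ltNge vi /= mul0r mulr0.
rewrite /chart_integral -(@intnZ _ m)//.
- by congr (intn _ _ _); apply/funext => v; rewrite -cone_integral.
- rewrite mule_ge0 ?GammaFun_ge0// lee_fin; apply: prodr_ge0 => i _.
  by rewrite divr_ge0 ?powR_ge0// fine_ge0// GammaFun_ge0.
- by move=> v; rewrite lee_fin indic_sd_kernel_ge0.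
- by apply: measurable_chart_integrand => //; exact: measurable_sd_kernel.
Qed.

End fixed_parameters.

(** The constant [K s]; [sd_norm_gt0E] shows that [fine] is applied to a finite value. *)
Definition sd_norm (s : R) : R := fine ((sd_const pi s)%:E * GammaFun s^-1).

Lemma chart_integral_ge0 (A : set (m.+1.-tuple R)) s x : A `<=` osimplex m.+1 ->
  (0 <= chart_integral A (sd_kernel pi s x))%E.
Proof.
by move=> AS; apply: intn_ge0 => v; rewrite lee_fin indic_sd_kernel_ge0.
Qed.

(* The total mass 1 forces the normalising constant, hence Gamma(1/s), to be positive and finite. *)
Lemma sd_norm_gt0E s x (X : 'I_m.+1 -> {RV P >-> R}) : 0 < s -> osimplex m.+1 x ->
  SD_family P (sd_shape pi s) (sd_rate pi x) (fun i => X i) ->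
  0 < sd_norm s /\ (sd_norm s)%:E = ((sd_const pi s)%:E * GammaFun s^-1)%E.
Proof.
move=> s0 xS SDX.
have := law_chart s0 xS SDX (@measurable_osimplex R m.+1) (@subset_refl _ _).
rewrite (law_osimplex SDX).
have K0 : (0 <= (sd_const pi s)%:E * GammaFun s^-1)%E.
  rewrite mule_ge0 ?GammaFun_ge0// lee_fin; apply: prodr_ge0 => i _.
  by rewrite divr_ge0 ?powR_ge0// fine_ge0// GammaFun_ge0.
rewrite /sd_norm; move: ((sd_const pi s)%:E * GammaFun s^-1)%E K0.
have := @chart_integral_ge0 (osimplex m.+1) s x (@subset_refl _ _).
move: (chart_integral _ _) => Z Z0 [k|_|//] => [|].
  rewrite lee_fin le_eqVlt => /predU1P[<-|k0 _]; last by [].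
  by rewrite mul0e => /eqP; rewrite onee_eq0.
move: Z0; rewrite le_eqVlt => /predU1P[<-|Z0].
  by rewrite mule0 => /eqP; rewrite onee_eq0.
by rewrite gt0_mulye.
Qed.

Lemma law_chart_norm s x (X : 'I_m.+1 -> {RV P >-> R}) (A : set (m.+1.-tuple R)) :
  0 < s -> osimplex m.+1 x ->
  SD_family P (sd_shape pi s) (sd_rate pi x) (fun i => X i) ->
  measurable A -> A `<=` osimplex m.+1 ->
  law_closure P (fun i => X i) A =
  ((sd_norm s)%:E * chart_integral A (sd_kernel pi s x))%E.
Proof.
by move=> s0 xS SDX mA AS; rewrite (law_chart s0 xS SDX)// (sd_norm_gt0E s0 xS SDX).2.
Qed.

End scaled_dirichlet_law.

(** * Small boxes in the chart and the filter they generate *)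

Section chart_boxes.
Context {R : realType}.
Local Notation leb := (@lebesgue_measure R).

Lemma iter_integralE k (g : (nat -> R) -> \bar R) :
  iter_integral k g = intn k g (fun=> 0).
Proof.
by elim: k g => //= k IH g; apply: eq_integral => t _; rewrite IH intn_upd.
Qed.

Lemma intnN k (g : (nat -> R) -> \bar R) v : (forall v, 0 <= g v)%E ->
  intn k (fun w => - g w)%E v = (- intn k g v)%E.
Proof.
move=> g0; elim: k v => //= k IH v; rewrite /intc -integral_ge0N.
  by apply: eq_integral => t _; rewrite IH.
by move=> t _; exact: intn_ge0.
Qed.

(** Written as a product so that [intn_prod] computes its integral. *)
Definition box_indic m (c : nat -> R) (e : R) (v : nat -> R) : R :=
  \prod_(0 <= i < m) \1_(`](c i - e), (c i + e)[%classic) (v i).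

Lemma box_indicE m c e v :
  box_indic m c e v = (`[< forall i, (i < m)%N -> `|v i - c i| < e >])%:R.
Proof.
rewrite /box_indic; have [h|/existsNP[i /not_implyP[im h]]] :=
    pselect (forall i, (i < m)%N -> `|v i - c i| < e).
  rewrite asboolT// big_nat big1// => i /andP[_ im].
  by rewrite indicE mem_set//= in_itv/= -ltr_distl; exact: h.
rewrite asboolF; last by move=> /(_ i im).
rewrite big_mkord (bigD1 (Ordinal im))//= indicE memNset ?mul0r//=.
by rewrite in_itv/= -ltr_distl.
Qed.

Lemma intn_box m c e v : 0 < e ->
  intn m (fun w => (box_indic m c e w)%:E) v = ((2 * e) ^+ m)%:E.
Proof.
move=> e0; rewrite /box_indic.
rewrite (@intn_prod _ m m (fun i => \1_(`](c i - e), (c i + e)[%classic)) (fun=> 2 * e))//.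
- by rewrite (big_geq (leqnn m)) mulr1 prodr_const_nat subn0.
- move=> i _; rewrite integral_indic// setIT /= lebesgue_measure_itv/= lte_fin.
  by rewrite ltrD2l gtrN// -EFinB; congr (_%:E); ring.
Qed.

Lemma measurable_box_indic m c e : measurable_env_fun m (fun v => (box_indic m c e v)%:E).
Proof.
apply/measurable_EFinP; apply: (@measurable_prod_coord _ m
  (fun i => \1_(`](c i - e), (c i + e)[%classic))) => i.
exact: measurable_indic.
Qed.

Lemma box_indic_ge0 m c e v : 0 <= box_indic m c e v.
Proof. by rewrite box_indicE. Qed.

(** The constant may be negative, as can the lower bounds in [continuous_density_unique]; [intnN]
    reduces that case to the nonnegative one. *)
Lemma intn_box_const m c e k v : 0 < e ->
  intn m (fun w => (k * box_indic m c e w)%:E) v = (k * (2 * e) ^+ m)%:E.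
Proof.
move=> e0; have nonneg k' : 0 <= k' ->
    intn m (fun w => (k' * box_indic m c e w)%:E) v = (k' * (2 * e) ^+ m)%:E.
  move=> k0; rewrite EFinM -(intn_box m c v e0) -(@intnZ _ m)//.
  - by move=> w; rewrite lee_fin box_indic_ge0.
  - exact: measurable_box_indic.
have [|k0] := leP 0 k; first exact: nonneg.
rewrite (_ : (fun w => _) = (fun w => - ((- k) * box_indic m c e w)%:E)%E); last first.
  by apply/funext => w; rewrite -EFinN mulNr opprK.
rewrite intnN; last first.
  by move=> w; rewrite lee_fin mulr_ge0 ?box_indic_ge0// oppr_ge0 ltW.
by rewrite nonneg ?oppr_ge0 ?ltW// -EFinN mulNr opprK.
Qed.

Definition box_nbhs m (c : nat -> R) : set_system (nat -> R) :=
  filter_from [set e : R | 0 < e]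
    (fun e => [set v | forall i, (i < m)%N -> `|v i - c i| < e]).

Global Instance box_nbhs_filter m c : Filter (box_nbhs m c).
Proof.
apply: filter_from_filter; first by exists 1 => /=.
move=> e1 e2 /= e10 e20; exists (Num.min e1 e2); first by rewrite /= lt_min e10.
by move=> v h; split=> i im; have := h i im; rewrite lt_min => /andP[].
Qed.

Lemma cvg_box_coord m c i : (i < m)%N -> v i @[v --> box_nbhs m c] --> c i.
Proof.
move=> im; apply/cvgrPdist_lt => e e0; exists e => //= v h.
by rewrite distrC; exact: h.
Qed.

End chart_boxes.

(** * Continuity of the chart, the divergence and the kernel at a point of the simplex *)

Section chart_continuity.
Context {R : realType} (m : nat) (y : m.+1.-tuple R).
Hypothesis yS : osimplex m.+1 y.

Local Notation Y := (box_nbhs m (nth 0 y)).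

Lemma cvg_chart (i : 'I_m.+1) :
  tnth (simplex_chart m.+1 v) i @[v --> Y] --> tnth y i.
Proof.
have := ltn_ord i; rewrite ltnS leq_eqVlt => /orP[/eqP im|im]; last first.
  rewrite (_ : (fun v => _) = fun v : nat -> R => v i); last first.
    by apply/funext => v; rewrite tnth_mktuple/= im.
  by rewrite (tnth_nth 0); exact: cvg_box_coord.
rewrite (_ : (fun v => _) = fun v : nat -> R => 1 - \sum_(j < m) v j); last first.
  by apply/funext => v; rewrite tnth_mktuple/= im ltnn.
rewrite (_ : tnth y i = 1 - \sum_(j < m) nth 0 y j).
  apply: cvgB; first exact: cvg_cst.
  apply: cvg_big => [|j _]; first exact: add_continuous.
  by apply: cvg_box_coord.
rewrite -(proj2 yS) big_ord_recr/= (_ : ord_max = i); last exact: val_inj.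
rewrite addrAC -[LHS]add0r; congr (_ + _); apply/esym/eqP; rewrite subr_eq0; apply/eqP.
by apply: eq_bigr => j _; rewrite (tnth_nth 0).
Qed.

Arguments cvg_chart : clear implicits.

Lemma near_chart_osimplex : \forall v \near Y, osimplex m.+1 (simplex_chart m.+1 v).
Proof.
have : \forall v \near Y, forall i : 'I_m.+1, 0 < tnth (simplex_chart m.+1 v) i.
  apply: filter_forall => i; apply: (cvgr_gt _ (cvg_chart i)).
  exact: osimplex_gt0.
by apply: filterS => v v0; apply: osimplex_ge => //; exact: simplex_chart_sum.
Qed.

Lemma near_chart_supdist (e : R) : 0 < e ->
  \forall v \near Y, supdist (simplex_chart m.+1 v) y < e.
Proof.
move=> e0; have : \forall v \near Y,
    forall i : 'I_m.+1, `|tnth (simplex_chart m.+1 v) i - tnth y i| < e.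
  apply: filter_forall => i; have /cvgrPdist_lt/(_ e e0) := cvg_chart i.
  by apply: filterS => v; rewrite distrC.
by apply: filterS => v h; apply/supdist_ltP.
Qed.

Lemma cvg_chart_continuous (f : m.+1.-tuple R -> R) : continuous_on_simplex f ->
  f (simplex_chart m.+1 v) @[v --> Y] --> f y.
Proof.
move=> cf; apply/cvgrPdist_lt => e e0; have [r r0 Hr] := cf y yS e e0.
have := near_chart_supdist r0; apply: filterS2 near_chart_osimplex => v vS vy.
by rewrite distrC; exact: Hr.
Qed.

Lemma cvg_chart_prod :
  \prod_(i < m.+1) tnth (simplex_chart m.+1 v) i @[v --> Y] --> \prod_(i < m.+1) tnth y i.
Proof.
apply: cvg_big => [|j _]; first exact: mul_continuous.
exact: cvg_chart.
Qed.

Lemma cvg_GammaDiv (pi x : m.+1.-tuple R) : osimplex m.+1 pi -> (forall i, 0 < tnth x i) ->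
  GammaDiv pi (simplex_chart m.+1 v) x @[v --> Y] --> GammaDiv pi y x.
Proof.
move=> piS x0.
have y0 i : 0 < tnth y i by exact: osimplex_gt0.
have pi0 i : 0 < tnth pi i by exact: osimplex_gt0.
have cr i : tnth (simplex_chart m.+1 v) i / tnth x i @[v --> Y] --> tnth y i / tnth x i.
  by apply: cvgM; [exact: cvg_chart|exact: cvg_cst].
apply: cvgB.
  apply: (continuous_cvg _ (f := fun v => \sum_(i < m.+1)
      tnth pi i * (tnth (simplex_chart m.+1 v) i / tnth x i))).
    apply: continuous_ln; rewrite big_ord_recr/= ltr_wpDl//.
      by apply: sumr_ge0 => i _; rewrite mulr_ge0// ?divr_ge0// ltW.
    by rewrite mulr_gt0// divr_gt0.
  apply: cvg_big => [|j _]; first exact: add_continuous.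
  by apply: cvgM; [exact: cvg_cst|exact: cr].
apply: cvg_big => [|j _]; first exact: add_continuous.
apply: cvgM; first exact: cvg_cst.
apply: (continuous_cvg _ (f := fun v => tnth (simplex_chart m.+1 v) j / tnth x j)) => //.
by apply: continuous_ln; rewrite divr_gt0.
Qed.

Lemma cvg_sd_kernel (pi x : m.+1.-tuple R) (s : R) :
  osimplex m.+1 pi -> (forall i, 0 < tnth x i) ->
  sd_kernel pi s x (simplex_chart m.+1 v) @[v --> Y] --> sd_kernel pi s x y.
Proof.
move=> piS x0; apply: cvgM.
  apply: (continuous_cvg _ (f := fun v => - (GammaDiv pi (simplex_chart m.+1 v) x / s))).
    exact: continuous_expR.
  apply: cvgN; apply: cvgM; last exact: cvg_cst.
  exact: cvg_GammaDiv.
apply: cvgV; last exact: cvg_chart_prod.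
by rewrite gt_eqF// prodr_gt0// => i _; exact: osimplex_gt0.
Qed.

End chart_continuity.

(** * Nonnegativity of the divergence and its vanishing on the diagonal *)

Section divergence.
Context {R : realType} (n : nat) (pi : n.-tuple R).
Hypothesis piS : osimplex n pi.

(** Jensen's inequality for [ln] with weights [pi]: the tangent bound [ln (r / b) <= r / b - 1] at
    the mean [b] of the ratios is averaged. *)
Lemma GammaDiv_ge0 (y x : n.-tuple R) : (forall i, 0 < tnth y i) -> (forall i, 0 < tnth x i) ->
  0 <= GammaDiv pi y x.
Proof.
move=> y0 x0; rewrite /GammaDiv; set b := \sum_(i < n) _.
have pi0 i : 0 < tnth pi i by exact: osimplex_gt0.
have r0 i : 0 < tnth y i / tnth x i by rewrite divr_gt0.
have b0 : 0 < b.
  have b_ge0 : 0 <= b by apply: sumr_ge0 => i _; rewrite mulr_ge0// ltW.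
  (* If [b] were [0], each positive term would vanish, so there would be no index at all, against
     the sum [1] of [pi]. *)
  rewrite lt_neqAle b_ge0 andbT eq_sym; apply/negP => /eqP bE.
  have := proj2 piS; rewrite big1 ?(oner_eq0, eqxx)//; last first.
    move=> i _; have /eqP := bE; rewrite psumr_eq0; last first.
      by move=> j _; rewrite mulr_ge0// ltW.
    move=> /allP/(_ i); rewrite mem_index_enum => /(_ isT)/=.
    by rewrite mulf_eq0 (gt_eqF (pi0 i)) (gt_eqF (r0 i)).
  by move/eqP; rewrite eq_sym oner_eq0.
rewrite subr_ge0.
apply: (@le_trans _ _ (\sum_(i < n) (tnth pi i * (ln b - 1) +
    tnth pi i * (tnth y i / tnth x i) / b))).
  apply: ler_sum => i _; rewrite -mulrA -mulrDr ler_pM2l//.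
  set r := tnth y i / tnth x i.
  have rb : 0 < r / b by rewrite divr_gt0// /r.
  have := @le_ln1Dx R (r / b - 1); rewrite ltrBrDl subrr addrC subrK ln_div ?posrE ?/r//.
  by move=> /(_ rb); lra.
rewrite big_split/= -!mulr_suml (proj2 piS) mul1r -/b divff ?gt_eqF//.
by rewrite subrK.
Qed.

Lemma GammaDivxx (x : n.-tuple R) : (forall i, 0 < tnth x i) -> GammaDiv pi x x = 0.
Proof.
move=> x0; rewrite /GammaDiv.
under eq_bigr do rewrite divff ?gt_eqF// mulr1.
under [X in _ - X]eq_bigr do rewrite divff ?gt_eqF// ln1 mulr0.
by rewrite (proj2 piS) ln1 big1_eq subr0.
Qed.

End divergence.

(** * Bounds for chart integrals and uniqueness of a continuous density *)

Section chart_integral_bounds.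
Context {R : realType} (m : nat) (pi x : m.+1.-tuple R).
Hypotheses (piS : osimplex m.+1 pi) (xS : osimplex m.+1 x).

(** On a small box around [y] the chart stays in [G] and the divergence below its value at [y] plus
    [e]; moreover [1 / (y_1 ... y_n) >= 1] on the simplex. So [c] is the volume of the box,
    independent of [s]. *)
Lemma chart_integral_open_ge (G : set (m.+1.-tuple R)) (y : m.+1.-tuple R) (e : R) :
  rel_open G -> G y -> 0 < e ->
  exists2 c : R, 0 < c & forall s, 0 < s ->
    ((c * expR (- ((GammaDiv pi y x + e) / s)))%:E <=
      chart_integral G (sd_kernel pi s x))%E.
Proof.
move=> [GS Gopen] Gy e0; have yS := GS _ Gy.
have x0 i : 0 < tnth x i by exact: osimplex_gt0.
have [r r0 Hr] := Gopen _ Gy.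
have nearG : \forall v \near box_nbhs m (nth 0 y), G (simplex_chart m.+1 v).
  have := near_chart_supdist yS r0; apply: filterS2 (near_chart_osimplex yS) => v.
  exact: Hr.
have nearGamma : \forall v \near box_nbhs m (nth 0 y),
    GammaDiv pi (simplex_chart m.+1 v) x < GammaDiv pi y x + e.
  by apply: (cvgr_lt _ (@cvg_GammaDiv _ _ _ yS _ _ piS x0)); rewrite ltrDl.
have [r' /= r'0 Hr'] : box_nbhs m (nth 0 y) ([set v | G (simplex_chart m.+1 v)] `&`
   [set v | GammaDiv pi (simplex_chart m.+1 v) x < GammaDiv pi y x + e]) by exact: filterI.
exists ((2 * r') ^+ m); first by rewrite exprn_gt0// mulr_gt0.
move=> s s0; rewrite mulrC -(intn_box_const m (nth 0 y) _ (fun=> 0) r'0).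
apply: le_intn => v; rewrite lee_fin box_indicE.
case: asboolP => [/Hr'[Gv Gav]|_]; last by rewrite mulr0 indic_sd_kernel_ge0.
have vS := GS _ Gv.
rewrite mulr1 indicE mem_set// mul1r /sd_kernel ler_pdivlMr; last first.
  by rewrite prodr_gt0// => i _; exact: osimplex_gt0.
apply: (@le_trans _ _ (expR (- ((GammaDiv pi y x + e) / s)))).
  rewrite ler_piMr ?expR_ge0// prodr_ile1// => i _.
  by have /andP[/ltW -> ->] := proj1 vS i.
by rewrite ler_expR lerN2 ler_pM2r ?invr_gt0// ltW.
Qed.

(** The factor [1 / (y_1 ... y_n)] is common to both kernels, so comparing the exponentials on [A]
    suffices. *)
Lemma le_chart_integral (A B : set (m.+1.-tuple R)) (k s t : R) :
  A `<=` B -> B `<=` osimplex m.+1 -> 0 <= k ->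
  (forall y, A y -> expR (- (GammaDiv pi y x / s)) <= k * expR (- (GammaDiv pi y x / t))) ->
  measurable B ->
  (chart_integral A (sd_kernel pi s x) <= k%:E * chart_integral B (sd_kernel pi t x))%E.
Proof.
move=> AB BS k0 Hk mB; rewrite /chart_integral -(@intnZ _ m)//; last 2 first.
- by move=> v; rewrite lee_fin indic_sd_kernel_ge0.
- by apply: measurable_chart_integrand => //; exact: measurable_sd_kernel.
apply: le_intn => v; rewrite -EFinM lee_fin; set y := simplex_chart _ _.
have [Ay|Ay] := pselect (A y); last first.
  by rewrite [in leLHS]indicE memNset// mul0r mulr_ge0// indic_sd_kernel_ge0.
rewrite !indicE !mem_set//; last exact: AB.
rewrite !mul1r /sd_kernel mulrA ler_pM2r ?Hk// invr_gt0 prodr_gt0// => i _.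
by apply: osimplex_gt0; apply: BS; exact: AB.
Qed.

(* Compare the two integrals over boxes shrinking to [y]. *)
Lemma continuous_density_unique (f : m.+1.-tuple R -> R) (k s : R) (y : m.+1.-tuple R) :
  0 <= k -> continuous_on_simplex f -> osimplex m.+1 y ->
  (forall A, measurable A -> A `<=` osimplex m.+1 ->
    (k%:E * chart_integral A (sd_kernel pi s x))%E = aitchison_integral A f) ->
  f y = Num.sqrt m.+1%:R * (k * expR (- (GammaDiv pi y x / s))).
Proof.
move=> k0 cf yS Hint.
have x0 i : 0 < tnth x i by exact: osimplex_gt0.
have prod0 z : osimplex m.+1 z -> 0 < \prod_(i < m.+1) tnth z i :> R.
  by move=> zS; rewrite prodr_gt0// => i _; exact: osimplex_gt0.
have sqn0 : 0 < Num.sqrt m.+1%:R :> R by rewrite sqrtr_gt0.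
(* [a] and [b] are the two candidate densities against Lebesgue measure in the chart. *)
pose a z := f z / (Num.sqrt m.+1%:R * \prod_(i < m.+1) tnth z i).
pose b z := k * sd_kernel pi s x z.
suff ab : a y = b y.
  move/(congr1 (fun z => z * (Num.sqrt m.+1%:R * \prod_(i < m.+1) tnth y i))): ab.
  rewrite /a divfK; last by rewrite mulf_neq0// gt_eqF// prod0.
  by move=> ->; rewrite /b /sd_kernel; field; rewrite gt_eqF// prod0.
have ca : a (simplex_chart m.+1 v) @[v --> box_nbhs m (nth 0 y)] --> a y.
  apply: cvgM; first exact: cvg_chart_continuous.
  apply: cvgV; first by rewrite mulf_neq0// gt_eqF// prod0.
  by apply: cvgM; [exact: cvg_cst|exact: cvg_chart_prod].
have cb : b (simplex_chart m.+1 v) @[v --> box_nbhs m (nth 0 y)] --> b y.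
  by apply: cvgM; [exact: cvg_cst|exact: cvg_sd_kernel].
apply/eqP; rewrite -subr_eq0 -normr_le0; apply/ler_addgt0Pr => e e0; rewrite add0r.
have e20 : 0 < e / 2 by rewrite divr_gt0.
move: ca => /cvgrPdist_lt/(_ _ e20) na; move: cb => /cvgrPdist_lt/(_ _ e20) nb.
have [r /= r0 Hr] := filterI (near_chart_osimplex yS) (filterI na nb).
(* Only the first [m] coordinates are constrained, so that in the chart [A] is exactly the box of
   half-side [r]. *)
pose A : set (m.+1.-tuple R) := osimplex m.+1 `&`
  \bigcap_(i in [set i : 'I_m.+1 | (i < m)%N]) [set z | `|tnth z i - nth 0 y i| < r].
have AS : A `<=` osimplex m.+1 by move=> z [].
have mA : measurable A.
  apply: measurableI; first exact: measurable_osimplex.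
  apply: fin_bigcap_measurable => // i _.
  have : measurable_fun [set: m.+1.-tuple R] (fun z : m.+1.-tuple R => `|tnth z i - nth 0 y i| < r).
    apply: measurable_fun_ltr => //; apply: measurableT_comp => //.
    by apply: measurable_funB => //; exact: measurable_tnth.
  by move=> /(_ measurableT [set true]); rewrite setTI; exact.
have AE v : A (simplex_chart m.+1 v) <-> forall i, (i < m)%N -> `|v i - nth 0 y i| < r.
  split=> [[_ h] i im|h].
    have := h (Ordinal (leqW im)) im.
    by rewrite /= tnth_mktuple/= im.
  split; first exact: (Hr v h).1.
  by move=> i /= im; rewrite tnth_mktuple/= im; exact: h.
have indA v : \1_A (simplex_chart m.+1 v) = box_indic m (nth 0 y) r v :> R.
  rewrite indicE box_indicE; congr (nat_of_bool _)%:R.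
  apply/idP/idP => [|/asboolP h]; last by apply/mem_set/AE.
  by rewrite inE => /AE h; apply/asboolP.
have := Hint A mA AS; rewrite /aitchison_integral iter_integralE /=.
set Ia := intn m _ _; set Ib := (k%:E * _)%E => Iab.
pose V := (2 * r) ^+ m; have V0 : 0 < V by rewrite exprn_gt0// mulr_gt0.
(* An integrand within [e / 2] of [z] on a box of volume [V] has integral within [e / 2 * V] of
   [z * V]. This rests on monotonicity alone, [f] not being known to be measurable. *)
have sandwich (h : (nat -> R) -> \bar R) (z : R) (w : (nat -> R) -> R) :
    (forall v, h v = (w v * box_indic m (nth 0 y) r v)%:E) ->
    (forall v, (forall i, (i < m)%N -> `|v i - nth 0 y i| < r) -> `|z - w v| < e / 2) ->
    (((z - e / 2) * V)%:E <= intn m h (fun=> 0%R) <= ((z + e / 2) * V)%:E)%E.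
  move=> hE hw; rewrite -!(intn_box_const m (nth 0 y) _ (fun=> 0) r0).
  apply/andP; split; apply: le_intn => v; rewrite hE lee_fin box_indicE;
    case: asboolP => [/hw|_]; rewrite ?mulr0// !mulr1 ltr_distl => /andP[h1 h2].
    by rewrite lerBlDr ltW.
  by move: h1; rewrite ltrBlDr => /ltW; rewrite -lerBlDr => ?; lra.
have : (((a y - e / 2) * V)%:E <= Ia <= ((a y + e / 2) * V)%:E)%E.
  apply: (sandwich _ _ (fun v => a (simplex_chart m.+1 v))) => v; last by move=> /Hr[_ []].
  rewrite -indA indicE; case: asboolP => [[_ Av]|nAv].
    by rewrite mem_set// mulr1.
  rewrite memNset ?mulr0// => Av; apply: nAv; split=> //.
  have [vS _] := AS _ Av.
  have sum1 : \sum_(j < m) v j < 1.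
    have /andP[] := vS ord_max; rewrite tnth_mktuple/= ltnn => + _.
    by rewrite subr_gt0.
  have v0 (j : 'I_m) : 0 < v j.
    have /andP[] := vS (widen_ord (leqnSn m) j).
    by rewrite tnth_mktuple/= ltn_ord.
  split=> //= j; rewrite v0/=; apply: le_lt_trans sum1.
  by rewrite (bigD1 j)//= lerDl; apply: sumr_ge0 => i _; exact: ltW.
have : (((b y - e / 2) * V)%:E <= Ib <= ((b y + e / 2) * V)%:E)%E.
  rewrite /Ib /chart_integral -(@intnZ _ m)//; last 2 first.
  - by move=> v; rewrite lee_fin indic_sd_kernel_ge0.
  - by apply: measurable_chart_integrand => //; exact: measurable_sd_kernel.
  apply: (sandwich _ _ (fun v => b (simplex_chart m.+1 v))) => v; last by move=> /Hr[_ []].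
  by rewrite indA -EFinM /b; congr (_%:E); ring.
(* The same number lies in both intervals, hence [a y] and [b y] differ by at most [e]. *)
rewrite Iab => /andP[b1 b2] /andP[a1 a2].
have := le_trans a1 b2; have := le_trans b1 a2; rewrite !lee_fin !ler_pM2r// => h1 h2.
by rewrite ler_norml; apply/andP; split; lra.
Qed.

End chart_integral_bounds.

(** * Limits superior and inferior, and arithmetic of scaled logarithms *)

Section limits.
Context {R : realType}.

Lemma cvg_mul_at_right0 (a : R) : (fun s : R => s * a) @ 0^'+ --> 0.
Proof.
rewrite -[X in _ --> X](mul0r a); apply: cvg_at_right_filter.
by apply: cvgM; [exact: cvg_id|exact: cvg_cst].
Qed.

Lemma limf_esup_le (f : R -> \bar R) (F : set_system R) (l : R) :
  (forall e, 0 < e -> \forall s \near F, (f s <= (l + e)%:E)%E) ->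
  (limf_esup f F <= l%:E)%E.
Proof.
move=> h; apply/lee_addgt0Pr => e e0; rewrite -EFinD limf_esupE.
apply: ge_ereal_inf; exists (ereal_sup (f @` [set s | (f s <= (l + e)%:E)%E])).
  by exists [set s | (f s <= (l + e)%:E)%E] => //; exact: h.
by apply: ge_ereal_sup => _ [s /= + <-].
Qed.

Lemma limf_einf_ge (f : R -> \bar R) (F : set_system R) (l : R) :
  (forall e, 0 < e -> \forall s \near F, ((l - e)%:E <= f s)%E) ->
  (l%:E <= limf_einf f F)%E.
Proof.
move=> h; apply/lee_subgt0Pr => e e0; rewrite -EFinB limf_einfE.
apply: le_ereal_sup_tmp; exists (ereal_inf (f @` [set s | ((l - e)%:E <= f s)%E])).
  by exists [set s | ((l - e)%:E <= f s)%E] => //; exact: h.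
by apply: le_ereal_inf_tmp => _ [s /= + <-].
Qed.

Lemma elog_le (u : \bar R) (r : R) : 0 < r -> (u <= r%:E)%E -> (elog u <= (ln r)%:E)%E.
Proof.
move=> r0; case: u => [u| |]//=; rewrite ?leNye// lee_fin => ur.
by case: ifPn => u0; rewrite ?leNye// lee_fin ler_ln ?posrE.
Qed.

Lemma elog_ge (u : \bar R) (r : R) : 0 < r -> (r%:E <= u)%E -> ((ln r)%:E <= elog u)%E.
Proof.
move=> r0; case: u => [u| |]//=; rewrite ?leey// lee_fin => ru.
by rewrite (lt_le_trans r0 ru) lee_fin ler_ln ?posrE// (lt_le_trans r0 ru).
Qed.

Lemma ler_mul_ln (s a b : R) : 0 < s -> 0 < a -> a <= b -> s * ln a <= s * ln b.
Proof. by move=> s0 a0 ab; rewrite ler_pM2l// ler_ln ?posrE// (lt_le_trans a0 ab). Qed.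

Lemma ln_mul_expR (a b z : R) : 0 < a -> 0 < b ->
  ln (a * (b * expR z)) = ln a + (ln b + z).
Proof. by move=> a0 b0; rewrite !lnM ?posrE ?mulr_gt0 ?expR_gt0// expRK. Qed.

Lemma ln_mul_expR_div (a b z : R) : 0 < a -> 0 < b ->
  ln (a * expR z / b) = ln a + z - ln b.
Proof.
by move=> a0 b0; rewrite ln_div ?posrE ?mulr_gt0 ?expR_gt0// lnM ?posrE ?expR_gt0// expRK.
Qed.

Lemma scaled_log_le (s a b z : R) : 0 < s -> a + (b + - (z / s)) <= 0 -> s * a <= z - s * b.
Proof.
move=> s0 h; have : s * (a + (b + - (z / s))) <= 0 by rewrite pmulr_rle0.
have -> : s * (a + (b + - (z / s))) = s * a + s * b - z by field; rewrite gt_eqF.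
lra.
Qed.

(** For the upper bound: after scaling by [s], the tilted exponent is [- z] plus terms that tend to
    [0]. *)
Lemma scaled_log_tilt (s a b z : R) : 0 < s ->
  s * (a + - (z * (s^-1 - 1)) - b) = - z + (s * a + (s * z - s * b)).
Proof. by move=> s0; field; rewrite gt_eqF. Qed.

Lemma norm_squeeze (a b c e : R) : a <= b -> b <= e / 2 - c ->
  `|0 - a| < e -> `|0 - c| < e / 2 -> `|0 - b| < e.
Proof.
move=> ab bc; rewrite !sub0r !normrN !ltr_norml => /andP[h1 h2] /andP[h3 h4].
by apply/andP; split; lra.
Qed.

Lemma le_of_EFinV (a b : R) (u v : \bar R) : 0 < a -> 0 < b ->
  u = a^-1%:E -> v = b^-1%:E -> (u <= v)%E -> b <= a.
Proof. by move=> a0 b0 -> ->; rewrite lee_fin lef_pV2. Qed.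

End limits.

(** * Asymptotics of the normalising constant, the uniform limit and the two large deviation
    bounds *)

Section large_deviations.
Context {R : realType} {d : measure_display} {T : measurableType d} {P : probability T R}.
Context {m : nat} (pi : m.+1.-tuple R).
Hypothesis piS : osimplex m.+1 pi.
Variable X : R -> m.+1.-tuple R -> 'I_m.+1 -> {RV P >-> R}.
Hypothesis hX : forall s : R, 0 < s -> forall x : m.+1.-tuple R, osimplex m.+1 x ->
  SD_family P (sd_shape pi s) (sd_rate pi x) (fun i => X s x i).

Local Notation K := (sd_norm pi).

Lemma sd_norm_gt0 s : 0 < s -> 0 < K s.
Proof. by move=> s0; have [] := sd_norm_gt0E piS s0 piS (hX s0 piS). Qed.

Lemma rel_open_osimplex : rel_open (@osimplex R m.+1).
Proof. by split=> // y yS; exists 1. Qed.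

(** Total mass [1] of the law. The value is free of [x], so [K s] can be studied at [x = pi]. *)
Lemma chart_integral_osimplex s x : 0 < s -> osimplex m.+1 x ->
  chart_integral (osimplex m.+1) (sd_kernel pi s x) = ((K s)^-1)%:E.
Proof.
move=> s0 xS; have K0 := sd_norm_gt0 s0.
have := law_chart_norm piS s0 xS (hX s0 xS) (@measurable_osimplex R _) (@subset_refl _ _).
rewrite (law_osimplex (hX s0 xS)) => E.
rewrite -[LHS]mul1e -[X in (X%:E * _)%E](@mulVf _ (K s)) ?gt_eqF// EFinM -muleA -E.
by rewrite mule1.
Qed.

(** With [D] the divergence, [exp (- D / s)] splits into [exp (- D * (1 / s - 1))], bounded through
    [I], and [exp (- D)], whose kernel has integral [1 / K 1] over the simplex. *)
Lemma le_law_closure s x (A : set (m.+1.-tuple R)) (I : R) : 0 < s < 1 -> osimplex m.+1 x ->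
  measurable A -> A `<=` osimplex m.+1 -> (forall y, A y -> I <= GammaDiv pi y x) ->
  (law_closure P (fun i => X s x i) A <= (K s * expR (- (I * (s^-1 - 1))) / K 1)%:E)%E.
Proof.
move=> /andP[s0 s1] xS mA AS IA.
rewrite (law_chart_norm piS s0 xS (hX s0 xS))// -mulrA EFinM.
rewrite lee_pmul2l ?lte_fin ?sd_norm_gt0// EFinM -(chart_integral_osimplex ltr01 xS).
apply: le_chart_integral => //.
  move=> y Ay; rewrite -expRD ler_expR divr1 -opprD lerN2.
  rewrite -lerBrDr -[X in _ <= _ - X]mulr1 -mulrBr ler_wpM2r ?IA//.
  by rewrite subr_ge0 invf_ge1// ltW.
exact: measurable_osimplex.
Qed.

Lemma law_closure_ge x (G : set (m.+1.-tuple R)) y (e : R) : osimplex m.+1 x ->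
  rel_open G -> G y -> 0 < e ->
  exists2 c : R, 0 < c & forall s, 0 < s ->
    ((K s * (c * expR (- ((GammaDiv pi y x + e) / s))))%:E <=
      law_closure P (fun i => X s x i) G)%E.
Proof.
move=> xS Gopen Gy e0; have [c c0 Hc] := chart_integral_open_ge piS xS Gopen Gy e0.
exists c => // s s0; rewrite (law_chart_norm piS s0 xS (hX s0 xS))//.
- by rewrite EFinM lee_pmul2l ?lte_fin ?sd_norm_gt0// Hc.
- exact: measurable_rel_open.
- by case: Gopen.
Qed.

Lemma sd_norm_ge_at1 s : 0 < s -> s <= 1 -> K 1 <= K s.
Proof.
move=> s0 s1; apply: (le_of_EFinV (sd_norm_gt0 s0) (sd_norm_gt0 (@ltr01 R))
  (chart_integral_osimplex s0 piS) (chart_integral_osimplex ltr01 piS)).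
rewrite -[leRHS]mul1e.
apply: (le_chart_integral _ _ ler01 _ (@measurable_osimplex R m.+1)) => //.
move=> y yS; rewrite mul1r ler_expR lerN2 divr1 ler_peMr ?invf_ge1//.
by apply: GammaDiv_ge0 => // i; exact: osimplex_gt0.
Qed.

Lemma sd_norm_log_cvg0 : s * ln (K s) @[s --> 0^'+] --> 0.
Proof.
apply/cvgrPdist_lt => e e0; have e20 : 0 < e / 2 by rewrite divr_gt0.
(* Centre and parameter are both [pi], where the divergence is [0], and the open set is the whole
   simplex, of mass [1]. *)
have [c c0 Hc] := law_closure_ge piS rel_open_osimplex piS e20.
have pi0 i : 0 < tnth pi i by exact: osimplex_gt0.
have /cvgrPdist_lt/(_ e e0) near1 := cvg_mul_at_right0 (ln (K 1)).
have /cvgrPdist_lt/(_ _ e20) nearc := cvg_mul_at_right0 (ln c).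
near=> s.
have s0 : 0 < s by near: s; exact: nbhs_right_gt.
have s1 : s < 1 by near: s; exact: nbhs_right_lt.
have Ks0 := sd_norm_gt0 s0.
have K10 := sd_norm_gt0 (@ltr01 R).
have lower : s * ln (K 1) <= s * ln (K s).
  exact: (ler_mul_ln s0 K10 (sd_norm_ge_at1 s0 (ltW s1))).
have upper : s * ln (K s) <= e / 2 - s * ln c.
  have := Hc s s0; rewrite (law_osimplex (hX s0 piS)) lee_fin (GammaDivxx piS pi0) add0r => H.
  have := ln_le0 H; rewrite (ln_mul_expR _ Ks0 c0) => H'.
  exact: scaled_log_le s0 H'.
apply: (norm_squeeze lower upper).
  by near: s.
by near: s.
Unshelve. all: by end_near. Qed.

Lemma density_log_uniform_cvg (f : R -> m.+1.-tuple R -> m.+1.-tuple R -> R) :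
  (forall s : R, 0 < s -> forall x : m.+1.-tuple R, osimplex m.+1 x ->
    continuous_on_simplex (f s x) /\
    (forall A : set (m.+1.-tuple R), measurable A -> A `<=` osimplex m.+1 ->
      law_closure P (fun i => X s x i) A = aitchison_integral A (f s x))) ->
  (fun s : R => ereal_sup
     [set e | exists x y : m.+1.-tuple R, [/\ osimplex m.+1 x, osimplex m.+1 y &
       e = (`| - (s * ln (f s x y)) - GammaDiv pi y x |)%:E]]) @ 0^'+ --> 0%E.
Proof.
move=> Hf.
have sqn0 : 0 < Num.sqrt m.+1%:R :> R by rewrite sqrtr_gt0.
(* The deviation is the same for all [x] and [y], so the supremum runs over a single value. *)
have fE s x y : 0 < s -> osimplex m.+1 x -> osimplex m.+1 y ->
    - (s * ln (f s x y)) - GammaDiv pi y x =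
    - (s * ln (Num.sqrt m.+1%:R) + s * ln (K s)).
  move=> s0 xS yS; have [cf lawf] := Hf s s0 x xS.
  have Ks0 := sd_norm_gt0 s0.
  rewrite (continuous_density_unique piS xS (ltW Ks0) cf yS (s := s)).
    rewrite (ln_mul_expR _ sqn0 Ks0).
    by field; rewrite gt_eqF.
  move=> A mA AS; rewrite -lawf//.
  by rewrite (law_chart_norm piS s0 xS (hX s0 xS)).
have gcvg : (`|- (s * ln (Num.sqrt m.+1%:R) + s * ln (K s))|)%:E @[s --> 0^'+] --> 0%E.
  apply: cvg_EFin; first exact: nearW.
  rewrite /comp /= -[X in _ --> X](@normr0 _ R) -[X in `|X|]oppr0 -[X in - X]addr0.
  apply: cvg_norm; apply: cvgN; apply: cvgD; last exact: sd_norm_log_cvg0.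
  exact: cvg_mul_at_right0.
apply: cvg_trans gcvg; apply: near_eq_cvg; near=> s.
have s0 : 0 < s by near: s; exact: nbhs_right_gt.
apply/esym; rewrite (_ : mkset _ = [set (`|- (s * ln (Num.sqrt m.+1%:R) + s * ln (K s))|)%:E]).
  by rewrite ereal_sup1.
apply/seteqP; split=> [_ [x [y [xS yS ->]]]|_ ->] /=; first by rewrite fE.
(* The point [pi] shows that the set under the supremum is not empty. *)
by exists pi, pi; split => //; rewrite fE.
Unshelve. all: by end_near. Qed.

Lemma ldp_upper_bound x (F : set (m.+1.-tuple R)) : osimplex m.+1 x -> rel_closed F ->
  (limf_esup (fun s : R => s%:E * elog (law_closure P (fun i => X s x i) F)) 0^'+
     <= - ereal_inf [set (GammaDiv pi y x)%:E | y in F])%E.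
Proof.
move=> xS Fcl; have FS : F `<=` osimplex m.+1 by case: Fcl.
have mF := measurable_rel_closed Fcl.
have x0 i : 0 < tnth x i by exact: osimplex_gt0.
(* Proved for every real lower bound [I] of the divergence on [F], because the infimum itself may be
   infinite. *)
have bound (I : R) : (forall y, F y -> I <= GammaDiv pi y x) ->
    (limf_esup (fun s : R => s%:E * elog (law_closure P (fun i => X s x i) F)) 0^'+
      <= (- I)%:E)%E.
  move=> IF; apply: limf_esup_le => e e0.
  have cvgh : s * ln (K s) + (s * I - s * ln (K 1)) @[s --> 0^'+] --> 0.
    rewrite -[X in _ --> X](addr0 0) -[X in _ --> _ + X](subr0 0).
    apply: cvgD; first exact: sd_norm_log_cvg0.
    by apply: cvgB; exact: cvg_mul_at_right0.
  have /cvgrPdist_lt/(_ e e0) nearh := cvgh.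
  near=> s.
  have s0 : 0 < s by near: s; exact: nbhs_right_gt.
  have s1 : s < 1 by near: s; exact: nbhs_right_lt.
  have Ks0 := sd_norm_gt0 s0.
  have K10 := sd_norm_gt0 (@ltr01 R).
  have s01 : 0 < s < 1 by rewrite s0.
  have pos := divr_gt0 (mulr_gt0 Ks0 (expR_gt0 (- (I * (s^-1 - 1))))) K10.
  have H := elog_le pos (le_law_closure s01 xS mF FS IF).
  rewrite (ln_mul_expR_div _ Ks0 K10) in H.
  apply: (@le_trans _ _ (s%:E * (ln (K s) + - (I * (s^-1 - 1)) - ln (K 1))%:E)%E).
    by rewrite lee_pmul2l ?lte_fin.
  rewrite -EFinM lee_fin.
  have hs : `|0 - (s * ln (K s) + (s * I - s * ln (K 1)))| < e by near: s.
  move: hs; rewrite sub0r normrN ltr_norml => /andP[_ hs].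
  rewrite (scaled_log_tilt _ _ _ s0).
  by rewrite lerD2l ltW.
(* On the empty set every real [I] is a lower bound, which drives the limit superior to [-oo]. *)
have [F0|/set0P[y0 Fy0]] := eqVneq F set0.
  rewrite [in leRHS]F0 image_set0 ereal_inf0 leeNy_eq; apply/eqP/eq_ninfty => I.
  by rewrite -[I]opprK; apply: bound => y; rewrite F0.
(* For nonempty [F] the infimum is real: it is at most the value at [y0] and at least [0]. *)
case E : (ereal_inf _) => [r| |].
- apply: bound => y Fy; rewrite -lee_fin -E; apply: ereal_inf_lbound.
  by exists y.
- have : (+oo <= (GammaDiv pi y0 x)%:E)%E.
    by rewrite -E; apply: ereal_inf_lbound; exists y0.
  by rewrite leye_eq.
- have : (0 <= ereal_inf [set (GammaDiv pi y x)%:E | y in F])%E.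
    apply: le_ereal_inf_tmp => _ [y Fy <-]; rewrite lee_fin.
    by apply: GammaDiv_ge0 => // i; apply: osimplex_gt0; exact: FS.
  by rewrite E.
Unshelve. all: by end_near. Qed.

Lemma ldp_lower_bound x (G : set (m.+1.-tuple R)) : osimplex m.+1 x -> rel_open G ->
  (- ereal_inf [set (GammaDiv pi y x)%:E | y in G]
     <= limf_einf (fun s : R => s%:E * elog (law_closure P (fun i => X s x i) G)) 0^'+)%E.
Proof.
(* Exchanging signs turns the claim into a lower bound for the limit inferior at each single point
   [y] of [G]. *)
move=> xS Gopen; rewrite leeNl; apply: le_ereal_inf_tmp => _ [y Gy <-].
rewrite leeNl -EFinN; apply: limf_einf_ge => e e0.
have e20 : 0 < e / 2 by rewrite divr_gt0.
have [c c0 Hc] := law_closure_ge xS Gopen Gy e20.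
have cvgh : s * ln (K s) + s * ln c @[s --> 0^'+] --> 0.
  rewrite -[X in _ --> X](addr0 0).
  by apply: cvgD; [exact: sd_norm_log_cvg0|exact: cvg_mul_at_right0].
have /cvgrPdist_lt/(_ _ e20) nearh := cvgh.
near=> s.
have s0 : 0 < s by near: s; exact: nbhs_right_gt.
have Ks0 := sd_norm_gt0 s0.
have pos := mulr_gt0 Ks0 (mulr_gt0 c0 (expR_gt0 (- ((GammaDiv pi y x + e / 2) / s)))).
have H := elog_ge pos (Hc s s0); rewrite (ln_mul_expR _ Ks0 c0) in H.
apply: (@le_trans _ _
    (s%:E * (ln (K s) + (ln c - (GammaDiv pi y x + e / 2) / s))%:E)%E); last first.
  by rewrite lee_pmul2l ?lte_fin.
rewrite -EFinM lee_fin.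
have hs : `|0 - (s * ln (K s) + s * ln c)| < e / 2 by near: s.
move: hs; rewrite sub0r normrN ltr_norml => /andP[hs _].
have -> : s * (ln (K s) + (ln c - (GammaDiv pi y x + e / 2) / s)) =
    (s * ln (K s) + s * ln c) - GammaDiv pi y x - e / 2 by field; rewrite gt_eqF.
lra.
Unshelve. all: by end_near. Qed.

End large_deviations.

(** * The uniform limit and the large deviation principle together *)

Theorem mainTheorem4 (R : realType) (n : nat) (hn : (2 <= n)%N)
    (pi : n.-tuple R) (hpi : osimplex n pi)
    (d : measure_display) (T : measurableType d) (P : probability T R)
    (X : R -> n.-tuple R -> 'I_n -> {RV P >-> R})
    (hX : forall s : R, 0 < s -> forall x : n.-tuple R, osimplex n x ->
            SD_family P (sd_shape pi s) (sd_rate pi x) (fun i => X s x i)) :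
  (* (i) uniform convergence of -sigma log f to Gamma_pi *)
  (forall f : R -> n.-tuple R -> n.-tuple R -> R,
     (forall s : R, 0 < s -> forall x : n.-tuple R, osimplex n x ->
        continuous_on_simplex (f s x) /\
        (forall A : set (n.-tuple R), measurable A -> A `<=` osimplex n ->
           law_closure P (fun i => X s x i) A = aitchison_integral A (f s x))) ->
     (fun s : R => ereal_sup
        [set e | exists x y : n.-tuple R, [/\ osimplex n x, osimplex n y &
           e = (`| - (s * ln (f s x y)) - GammaDiv pi y x |)%:E]])
       @ 0^'+ --> 0%E)
  /\
  (* (ii) large deviation principle with speed 1/sigma and rate Gamma_pi(. || x) *)
  (forall x : n.-tuple R, osimplex n x ->
     (forall F : set (n.-tuple R), rel_closed F ->
        (limf_esup (fun s : R => s%:E * elog (law_closure P (fun i => X s x i) F))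
                   0^'+
         <= - ereal_inf [set (GammaDiv pi y x)%:E | y in F])%E)
     /\
     (forall G : set (n.-tuple R), rel_open G ->
        (- ereal_inf [set (GammaDiv pi y x)%:E | y in G]
         <= limf_einf (fun s : R => s%:E * elog (law_closure P (fun i => X s x i) G))
                      0^'+)%E)).
Proof.
case: n hn pi hpi X hX => [//|m] _ pi hpi X hX; split.
  exact: (density_log_uniform_cvg hpi hX).
move=> x xS; split=> [F Fcl|G Gopen].
  exact: (ldp_upper_bound hpi hX xS Fcl).
exact: (ldp_lower_bound hpi hX xS Gopen).
Qed.
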